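(* In the setting below, let $F_1,\dots,F_n\in K_w[\mathcal G\oplus\mathcal H]$ be nonzero, with $x$-initial terms $a_ix_1^{b_{i1}}\cdots x_n^{b_{in}}$ ($a_i\in K_w[\mathcal G]$), and suppose $j(F_1,\dots,F_n)=\det(b_{ij})\ne0$. Then for every $\Phi(\mathbf x)=\sum_{\mathbf k}\phi_{\mathbf k}\mathbf x^{\mathbf k}\in K_w^{\mathbf f}[\mathcal G\oplus\mathcal H]$, the series $\Phi(F_1,\dots,F_n)$ exists in $K_w[\mathcal G\oplus\mathcal H]$ and $$\mathop{\mathrm{Res}}_{\mathbf x}\Phi(F_1,\dots,F_n)\,J(F_1,\dots,F_n)=j(F_1,\dots,F_n)\,\mathop{\mathrm{Res}}_{\mathbf F}\Phi(F_1,\dots,F_n),$$ equivalently $$\mathop{\mathrm{CT}}_{\mathbf x}\Phi(F_1,\dots,F_n)\,LJ(F_1,\dots,F_n)=j(F_1,\dots,F_n)\,\mathop{\mathrm{CT}}_{\mathbf F}\Phi(F_1,\dots,F_n),$$ where the left-hand sides are computed in $K_w[\mathcal G\oplus\mathcal H]$ and $\mathop{\mathrm{Res}}_{\mathbf F}\Phi(\mathbf F)=\phi_{(-1,\dots,-1)}$, $\mathop{\mathrm{CT}}_{\mathbf F}\Phi(\mathbf F)=\phi_{\mathbf 0}$ are the coefficients of $\Phi(\mathbf x)$ regarded as an element of $K_w^{\mathbf f}[\mathcal G\oplus\mathcal H]$.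
   Context: $K$ is a field; a TOA-group is an abelian group with a translation-invariant total order; for a TOA-group $\mathcal A$, $K_w[\mathcal A]$ is the field of formal series $\sum c_at^a$ with well-ordered support; initial term = term of least order. Setting: $\mathcal G,\mathcal H$ abelian groups, $\mathcal H\cong\mathbb Z^n$ with basis $e_1,\dots,e_n$, and $\mathcal G\oplus\mathcal H$ carries a total order making it a TOA-group. Write $x_i=t^{e_i}$; every $\eta\in K_w[\mathcal G\oplus\mathcal H]$ is $\sum_{\mathbf k\in\mathbb Z^n}b_{\mathbf k}\mathbf x^{\mathbf k}$ with $b_{\mathbf k}\in K_w[\mathcal G]$; the $x$-initial term is the nonzero $b_{\mathbf k}\mathbf x^{\mathbf k}$ of least order. Operators: $\partial/\partial x_i$ acts termwise on exponents of $x_i$; $\mathop{\mathrm{CT}}_{\mathbf x}\eta=b_{\mathbf 0}$; $\mathop{\mathrm{Res}}_{\mathbf x}\eta=b_{(-1,\dots,-1)}$. Jacobian $J(F_1,\dots,F_n)=\det(\partial F_i/\partial x_j)$; log Jacobian $LJ(F_1,\dots,F_n)=\frac{x_1\cdots x_n}{F_1\cdots F_n}J(F_1,\dots,F_n)$; Jacobian number $j(F_1,\dots,F_n)=\det(b_{ij})$ where $a_i\mathbf x^{\mathbf b_i}$ is the $x$-initial term of $F_i$. For an injective endomorphism $\rho$ of $\mathcal G\oplus\mathcal H$, $a\le^\rho b\iff\rho(a)\le\rho(b)$, and $K_w^\rho[\mathcal G\oplus\mathcal H]$ is the field of formal series with support well-ordered for $\le^\rho$. If the initial term of $F_i$ is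 $c_it^{g_i}\mathbf x^{\mathbf b_i}$ ($c_i\in K$), $\mathbf f$ is the endomorphism fixing $\mathcal G$ with $e_i\mapsto g_i+\sum_jb_{ij}e_j$, and $K_w^{\mathbf f}=K_w^{\rho}$ with $\rho=\mathbf f$. For $\Phi=\sum_{\mathbf k}\phi_{\mathbf k}\mathbf x^{\mathbf k}$, $\Phi(F_1,\dots,F_n)=\sum_{\mathbf k}\phi_{\mathbf k}F_1^{k_1}\cdots F_n^{k_n}$ (strictly convergent sum). *)

(* Defs.v *)
From HB Require Import structures.
From mathcomp Require Import all_boot all_order fingroup perm all_algebra.
From mathcomp Require Import boolp classical_sets cardinality fsbigop.
From Stdlib Require Import ClassicalEpsilon.
Set Implicit Arguments. Unset Strict Implicit. Unset Printing Implicit Defensive.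
Import Order.TTheory GRing.Theory Num.Theory.
Local Open Scope ring_scope.
Local Open Scope classical_set_scope.

Section HahnSeries.
Variables (K : fieldType) (G : zmodType) (n : nat).

(* The group G (+) H with H = Z^n (basis e_1..e_n = the unit row vectors). *)
Definition grp := (G * 'rV[int]_n)%type.
Definition gadd (a b : grp) : grp := (a.1 + b.1, a.2 + b.2).
Definition gzero : grp := (0, 0).

Definition is_toa (le : grp -> grp -> Prop) : Prop :=
  [/\ (forall a, le a a),
      (forall a b, le a b -> le b a -> a = b),
      (forall a b c, le a b -> le b c -> le a c),
      (forall a b, le a b \/ le b a) &
      (forall a b c, le a b -> le (gadd a c) (gadd b c))].

Definition wo (T : Type) (le : T -> T -> Prop) (S : set T) : Prop :=
  forall U : set T, U `<=` S -> U !=set0 -> exists2 m, U m & forall u, U u -> le m u.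

(* formal series sum_a c_a t^a, as coefficient functions *)
Definition series := grp -> K.
Definition supp (f : series) : set grp := [set a | f a != 0].
Definition in_Kw (le : grp -> grp -> Prop) (f : series) := wo le (supp f).

Definition hzero : series := fun _ => 0.
Definition hmono (a : grp) : series := fun c => (c == a)%:R.
Definition hone : series := hmono gzero.
Definition hadd (f g : series) : series := fun c => f c + g c.
Definition hscale (x : K) (f : series) : series := fun c => x * f c.
Definition hmul (f g : series) : series := fun c =>
  \sum_(p \in [set p : grp * grp | gadd p.1 p.2 = c /\ f p.1 * g p.2 != 0])
     (f p.1 * g p.2).
Definition hexp (f : series) (m : nat) : series := iter m (hmul f) hone.

Definition hinv (le : grp -> grp -> Prop) (f : series) : series :=
  epsilon (inhabits hzero) (fun h => in_Kw le h /\ hmul f h = hone).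

Definition xmono (k : 'rV[int]_n) : series := hmono (0, k).

Definition summable (I : choiceType) (le : grp -> grp -> Prop) (fam : I -> series) :=
  wo le [set c | exists i, fam i c != 0] /\
  forall c, finite_set [set i | fam i c != 0].
Definition hsum (I : choiceType) (fam : I -> series) : series := fun c =>
  \sum_(i \in [set i | fam i c != 0]) fam i c.

Definition is_initial_exp (le : grp -> grp -> Prop) (f : series) (a : grp) :=
  f a != 0 /\ forall c, f c != 0 -> le a c.

Definition xcoef (f : series) (k : 'rV[int]_n) : G -> K := fun g => f (g, k).
Definition xterm (f : series) (k : 'rV[int]_n) : series :=
  fun a => if a.2 == k then f a else 0.
Definition is_xinit_exp (le : grp -> grp -> Prop) (f : series) (k : 'rV[int]_n) :=
  xterm f k != hzero /\
  forall k' a a', xterm f k' != hzero ->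
    is_initial_exp le (xterm f k) a -> is_initial_exp le (xterm f k') a' -> le a a'.

Definition hderiv (i : 'I_n) (f : series) : series := fun a =>
  ((a.2 0 i + 1)%:~R) * f (a.1, a.2 + delta_mx 0 i).

Definition jacobian (F : 'I_n -> series) : series :=
  \big[hadd/hzero]_(s : 'S_n)
     hscale ((-1) ^+ s) (\big[hmul/hone]_(i < n) hderiv (s i) (F i)).

Definition logjacobian (le : grp -> grp -> Prop) (F : 'I_n -> series) : series :=
  hmul (hmul (xmono (const_mx 1)) (\big[hmul/hone]_(i < n) hinv le (F i)))
       (jacobian F).

Definition ipow (le : grp -> grp -> Prop) (f : series) (z : int) : series :=
  match z with
  | Posz m => hexp f m
  | Negz m => hexp (hinv le f) m.+1
  end.
Definition Fpow (le : grp -> grp -> Prop) (F : 'I_n -> series) (k : 'rV[int]_n) :=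
  \big[hmul/hone]_(i < n) ipow le (F i) (k 0 i).

(* the terms phi_k F^k of Phi(F), phi_k in K_w[G] embedded *)
Definition subst_term (le : grp -> grp -> Prop) (Phi : series) (F : 'I_n -> series)
    (k : 'rV[int]_n) : series :=
  hmul (fun a => if a.2 == 0 then Phi (a.1, k) else 0) (Fpow le F k).

Definition expmx (b : 'I_n -> 'rV[int]_n) : 'M[int]_n := \matrix_(i, j) b i 0 j.
Definition fendo (g : 'I_n -> G) (b : 'I_n -> 'rV[int]_n) (a : grp) : grp :=
  (a.1 + \sum_(i < n) (g i *~ a.2 0 i), a.2 *m expmx b).
Definition le_rho (le : grp -> grp -> Prop) (rho : grp -> grp) (a c : grp) :=
  le (rho a) (rho c).

End HahnSeries.

(* Main.v *)
Require Import Defs.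
From HB Require Import structures.
From mathcomp Require Import all_boot all_order fingroup perm all_algebra.
From mathcomp Require Import finmap boolp classical_sets cardinality fsbigop.
From mathcomp Require Import ring zify.
From mathcomp.multinomials Require Import monalg.
Set Implicit Arguments. Unset Strict Implicit. Unset Printing Implicit Defensive.
Import Order.TTheory GRing.Theory Num.Theory.
Local Open Scope ring_scope.
Local Open Scope classical_set_scope.

(* Write F_i = c_i t^(a_i) (1 + tau_i) with tau_i of positive support. By Higman's
   lemma the monoid generated by the supports of the tau_i is well-ordered, which
   gives the inverses of the F_i and the convergence of Phi(F). By linearity the
   theorem reduces to CT F^k LJ(F) = delta_(k,0) j(F), where LJ(F) = det (dlog F_i).
   For k_i != 0, k_i F^k LJ(F) is the determinant obtained from LJ(F) by replacing
   its i-th row by d(F^k); as the other rows are closed, this is a divergence and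
   its constant term vanishes. For k = 0 one replaces the rows dlog F_i by dlog of
   their initial monomials one at a time; the error has the row
   sum_m (-tau_i)^m d tau_i, each of whose terms is exact up to the factor m + 1.
   Both arguments divide by integers; they are run over the polynomial ring
   Z[X_c : c in K] and specialised along X_c |-> c. *)

(** * Totally ordered abelian groups and well-ordered subsets *)

(** The order is a bundled value so that the type of series can depend on it and carry ring
    instances. *)
Record toa (A : zmodType) := Toa {
  tle :> A -> A -> Prop;
  tle_refl : forall a, tle a a;
  tle_anti : forall a b, tle a b -> tle b a -> a = b;
  tle_trans : forall a b c, tle a b -> tle b c -> tle a c;
  tle_total : forall a b, tle a b \/ tle b a;
  tle_add : forall a b c, tle a b -> tle (a + c) (b + c) }.

Section WellOrder.
Variables (A : zmodType) (o : toa A).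
Implicit Types (U V S : set A).

Lemma tle_addl a b c : o a b -> o (c + a) (c + b).
Proof. by rewrite ![c + _]addrC; exact: tle_add. Qed.

Lemma tle_addr2 a b c : o (a + c) (b + c) -> o a b.
Proof. by move=> /(tle_add (- c)); rewrite !addrK. Qed.

Lemma tle_add2 a b c d : o a b -> o c d -> o (a + c) (b + d).
Proof. by move=> ab cd; apply: tle_trans (tle_add _ ab) (tle_addl _ cd). Qed.

Lemma tle_opp a b : o a b -> o (- b) (- a).
Proof. by move=> /(tle_add (- a - b)); rewrite addrA subrr sub0r addrCA subrr addr0. Qed.

Lemma wo_sub U V : U `<=` V -> wo o V -> wo o U.
Proof. by move=> UV wV X XU; apply: wV; apply: subset_trans UV. Qed.

(** Taking repeatedly the index of a least term of the remaining tail produces terms that never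
    decrease. *)
Lemma wo_nondecr_subseq U (s : nat -> A) : wo o U -> (forall i, U (s i)) ->
  exists f : nat -> nat, (forall i j, (i < j)%N -> (f i < f j)%N) /\
    (forall i j, (i <= j)%N -> o (s (f i)) (s (f j))).
Proof.
move=> wU sU.
have next i : exists j, (i <= j)%N /\ forall l, (i <= l)%N -> o (s j) (s l).
  have [||m [j ij <-] mmin] := wU [set x | exists2 j, (i <= j)%N & s j = x].
  - by move=> _ [j _ <-].
  - by exists (s i), i.
  by exists j; split=> // l il; apply: mmin; exists l.
have [N hN] := choice next.
pose f := fix f k := if k is k'.+1 then N (f k').+1 else N 0%N.
have fS k : (f k < f k.+1)%N by case: (hN (f k).+1).
have fmono : {homo f : i j / (i < j)%N} by apply: homo_ltn => //; exact: ltn_trans.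
exists f; split=> // i j; rewrite leq_eqVlt => /orP[/eqP-> |/fmono ij].
  exact: tle_refl.
case: i ij => [|i] ij; first by case: (hN 0%N) => _; apply.
by case: (hN (f i).+1) => [_]; apply; apply: ltn_trans ij; exact: fS.
Qed.

(** A nonempty subset without a minimum would yield, by choice, a strictly descending sequence,
    which has no good pair. *)
Lemma wo_good_seq U :
  (forall s : nat -> A, (forall i, U (s i)) ->
     exists i j, (i < j)%N /\ o (s i) (s j)) -> wo o U.
Proof.
move=> good X XU [x0 Xx0]; apply: contrapT => nomin.
have next (x : A) : exists y, X x -> X y /\ ~ o x y.
  case: (pselect (X x)) => [Xx|nXx]; last by exists x.
  apply: contrapT => /forallNP nex; apply: nomin; exists x => // u Xu.
  by apply: contrapT => nxu; apply: (nex u).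
have [N hN] := choice next.
have Xs i : X (iter i N x0) by elim: i => [|i IH] //=; case: (hN _ IH).
have dec i : ~ o (iter i N x0) (iter i.+1 N x0) by case: (hN _ (Xs i)).
have le_dec i : o (iter i.+1 N x0) (iter i N x0).
  by case: (tle_total o (iter i.+1 N x0) (iter i N x0)) => // /dec.
have le_decr i d : o (iter (i + d) N x0) (iter i N x0).
  elim: d => [|d IH]; first by rewrite addn0; exact: tle_refl.
  by rewrite addnS; apply: tle_trans IH; exact: le_dec.
have [i [j [ij le_ij]]] := good _ (fun i => XU _ (Xs i)).
apply: (dec i); apply: tle_trans le_ij _.
by rewrite -(subnKC ij); exact: le_decr.
Qed.

(** Pass to a subsequence along which the [U]-components never decrease, then to a further one for
    the [V]-components; any two of its terms form a good pair. *)
Lemma wo_sumset U V : wo o U -> wo o V ->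
  wo o [set c | exists a b, [/\ U a, V b & c = a + b]].
Proof.
move=> wU wV; apply: wo_good_seq => s sP.
have /choice[p pP] i : exists p : A * A, [/\ U p.1, V p.2 & s i = p.1 + p.2].
  by have [a [b P]] := sP i; exists (a, b).
have [|f [fmono fle]] := wo_nondecr_subseq (s := fun i => (p i).1) wU.
  by move=> i; case: (pP i).
have [|h [hmono hle]] := wo_nondecr_subseq (s := fun i => (p (f i)).2) wV.
  by move=> i; case: (pP (f i)).
exists (f (h 0%N)), (f (h 1%N)); split; first exact/fmono/hmono.
have [_ _ ->] := pP (f (h 0%N)); have [_ _ ->] := pP (f (h 1%N)).
by apply: tle_add2; [apply: fle; apply/ltnW/hmono | apply: hle].
Qed.

Lemma wo_union U V : wo o U -> wo o V -> wo o (U `|` V).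
Proof.
move=> wU wV X XUV [x Xx].
have [[u [Xu Uu]]|nU] := pselect ((X `&` U) !=set0); last first.
  apply: wV; last by exists x.
  by move=> y Xy; case: (XUV y Xy) => // Uy; case: nU; exists y.
have [||m [Xm Um] mmin] := wU (X `&` U); [by move=> y [] | by exists u |].
have [[v [Xv Vv]]|nV] := pselect ((X `&` V) !=set0); last first.
  exists m => // y Xy; case: (XUV y Xy) => Hy; first exact: mmin.
  by case: nV; exists y.
have [||m' [Xm' Vm'] mmin'] := wV (X `&` V); [by move=> y [] | by exists v |].
case: (tle_total o m m') => mm'; [exists m | exists m'] => // y Xy;
  case: (XUV y Xy) => Hy.
- exact: mmin.
- by apply: tle_trans mm' _; exact: mmin'.
- by apply: tle_trans mm' _; exact: mmin.
- exact: mmin'.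
Qed.

Lemma wo_set0 : wo o set0.
Proof. by move=> X X0 [x /X0]. Qed.

Lemma wo_set1 a : wo o [set a].
Proof.
move=> X X1 [x Xx]; exists x => // y Xy.
by rewrite (X1 x Xx) (X1 y Xy); exact: tle_refl.
Qed.

Lemma wo_bigcup n (U : 'I_n -> set A) : (forall i, wo o (U i)) ->
  wo o [set a | exists i, U i a].
Proof.
move=> wU.
suff: forall r : seq 'I_n, wo o [set a | exists2 i, i \in r & U i a].
  by move=> /(_ (enum 'I_n)); apply: wo_sub => a [i Ui]; exists i; rewrite ?mem_enum.
elim=> [|i r IH]; first by apply: wo_sub wo_set0 => a [].
apply: wo_sub (wo_union (wU i) IH) => a [j]; rewrite inE => /orP[/eqP->|jr] Ua.
  by left.
by right; exists j.
Qed.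

(* The minimum of the points with infinitely many predecessors would have an
   immediate predecessor with the same property. *)
Lemma finite_wo_dual U : wo o U -> wo (fun a b => o b a) U -> finite_set U.
Proof.
move=> wU wU'; apply: contrapT => infU.
have neqU : U !=set0.
  by apply/set0P/eqP => U0; apply: infU; rewrite U0; exact: finite_set0.
have [M UM Mmax] := wU' U (@subset_refl _ _) neqU.
pose Y := [set x | U x /\ ~ finite_set (U `&` [set y | o y x])].
have [| |m [Um im] mmin] := wU Y; first by move=> x [].
  exists M; split=> //; have -> // : U `&` [set y | o y M] = U.
  by apply/seteqP; split=> [x []//|x Ux]; split=> //; exact: Mmax.
pose Z := U `&` [set y | o y m /\ y <> m].
have infZ : ~ finite_set Z.
  move=> fZ; apply: im; apply: (@sub_finite_set _ _ (Z `|` [set m])); last first.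
    by rewrite finite_setU; split=> //; exact: finite_set1.
  move=> y [Uy ym]; case: (pselect (y = m)) => [->|ny]; first by right.
  by left; split.
have neqZ : Z !=set0.
  by apply/set0P/eqP => Z0; apply: infZ; rewrite Z0; exact: finite_set0.
have [|z [Uz [zm nzm]] zmax] := wU' Z _ neqZ; first by move=> y [].
apply: nzm; apply: tle_anti zm _; apply: mmin; split=> // fz; apply: infZ.
apply: sub_finite_set fz => y Zy; split; first by case: Zy.
exact: zmax.
Qed.

(** The reflection [a |-> c - a] sends this set into [V] and reverses the order, so the set is
    well-ordered in both directions. *)
Lemma finite_sum_pairs U V c : wo o U -> wo o V ->
  finite_set [set a | U a /\ V (c - a)].
Proof.
move=> wU wV; apply: finite_wo_dual; first by apply: wo_sub wU => a [].
move=> X XU [x Xx].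
have [||m [y Xy ym] mmin] := wV [set b | exists2 a, X a & c - a = b].
- by move=> _ [a Xa <-]; case: (XU a Xa).
- by exists (c - x), x.
exists y => // u Xu; have : o (c - y) (c - u) by rewrite ym; apply: mmin; exists u.
by move=> /tle_opp/(tle_add c); rewrite !opprB !subrK.
Qed.

(** * Higman's lemma and the monoid generated by a well-ordered set *)

(** Higman's embedding order: the first word is dominated letter by letter by a subword of the
    second. *)
Inductive emb : seq A -> seq A -> Prop :=
| emb_nil w : emb [::] w
| emb_skip v b w : emb v w -> emb v (b :: w)
| emb_cons a b v w : o a b -> emb v w -> emb (a :: v) (b :: w).

Definition word S (w : seq A) := forall x, x \in w -> S x.

Definition bad S (s : nat -> seq A) :=
  (forall i, word S (s i)) /\ forall i j, (i < j)%N -> ~ emb (s i) (s j).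

(* Nash-Williams' minimal bad sequence argument. *)
Lemma higman S : wo o S -> forall s, (forall i, word S (s i)) ->
  exists i j, (i < j)%N /\ emb (s i) (s j).
Proof.
move=> wS s sS; apply: contrapT => nogood.
have bads : bad S s by split=> // i j ij e; apply: nogood; exists i, j.
pose ext (p : seq (seq A)) :=
  exists2 t, bad S t & forall i, (i < size p)%N -> t i = nth [::] p i.
(* Among the words that extend [p] to the beginning of a bad sequence a shortest is taken; iterating
   gives the minimal bad sequence [w]. *)
have next (p : seq (seq A)) : exists x, ext p ->
    ext (rcons p x) /\ forall y, ext (rcons p y) -> (size x <= size y)%N.
  case: (pselect (ext p)) => [[t tb tp]|np]; last by exists [::].
  have exN : exists m, `[< exists2 y, ext (rcons p y) & size y = m >].
    exists (size (t (size p))); apply/asboolP; exists (t (size p)) => //.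
    exists t => // i; rewrite size_rcons ltnS nth_rcons leq_eqVlt.
    by case: ltngtP => //= [ip _|-> _]; [exact: tp | rewrite ?eqxx].
  case: (ex_minnP exN) => m /asboolP[y ey <-] mmin; exists y => _; split=> // z ez.
  by apply: mmin; apply/asboolP; exists z.
have [N hN] := choice next.
pose P := fix P k := if k is k'.+1 then rcons (P k') (N (P k')) else [::].
have sizeP k : size (P k) = k by elim: k => //= k IH; rewrite size_rcons IH.
have extP k : ext (P k).
  by elim: k => [|k IH] /=; [exists s | case: (hN _ IH)].
pose w k := N (P k).
have nthP k i : (i < k)%N -> nth [::] (P k) i = w i.
  elim: k => [|k IH] //=; rewrite ltnS nth_rcons sizeP leq_eqVlt.
  by case: ltngtP => //= [ik _|-> _]; [exact: IH | rewrite ?eqxx].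
have wb : bad S w.
  split=> [i|i j ij].
    have [t [tS _] tP] := extP i.+1.
    by rewrite -(nthP i.+1 i) // -tP ?sizeP.
  have [t [_ tb] tP] := extP j.+1.
  have E k : (k <= j)%N -> w k = t k by move=> kj; rewrite tP ?sizeP ?nthP.
  by rewrite !E ?(ltnW ij) //; exact: tb.
have w_ne k : w k = head 0 (w k) :: behead (w k).
  case E: (w k) => [|//]; case: wb => _ /(_ k k.+1 (ltnSn k)); rewrite E.
  by case; exact: emb_nil.
pose a k := head 0 (w k); pose v k := behead (w k).
have wE k : w k = a k :: v k by exact: w_ne.
have wordv k : word S (v k).
  by move=> x xv; apply: (wb.1 k); rewrite (wE k) inE xv orbT.
have [|f [fmono fle]] := wo_nondecr_subseq (s := a) wS.
  by move=> i; apply: (wb.1 i); rewrite wE mem_head.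
(* Keep [w] before index [f 0], then continue with the words of the subsequence stripped of their
   first letters. This is again bad, since prepending nondecreasing letters preserves embeddings. *)
pose t i := if (i < f 0%N)%N then w i else v (f (i - f 0%N)%N).
have tb : bad S t.
  split=> [i|i j ij]; rewrite /t.
    by case: ifP => _; [exact: wb.1 | exact: wordv].
  case: (ltnP j (f 0%N)) => jf; first by rewrite (ltn_trans ij jf); exact: wb.2.
  have fj0 : (f 0%N <= f (j - f 0%N))%N by case: (j - f 0%N)%N => // d; apply/ltnW/fmono.
  case: (ltnP i (f 0%N)) => jf' e.
    apply: (wb.2 i (f (j - f 0%N)%N)); first exact: leq_trans fj0.
    by rewrite (wE (f _)); exact: emb_skip.
  have lt_d : (i - f 0 < j - f 0)%N by rewrite ltn_sub2r // (leq_ltn_trans jf').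
  apply: (wb.2 _ _ (fmono _ _ lt_d)); rewrite !(wE (f _)).
  by apply: emb_cons => //; apply: fle; exact: ltnW.
(* [t] continues the same prefix with a word shorter by one letter, against the minimal choice of
   [w (f 0)]. *)
have [_ minw] := hN _ (extP (f 0%N)).
have : ext (rcons (P (f 0%N)) (v (f 0%N))).
  exists t => // i; rewrite size_rcons sizeP ltnS nth_rcons sizeP /t leq_eqVlt.
  by case: ltngtP => //= [i0 _|-> _]; [rewrite nthP | rewrite subnn].
by move=> /minw; rewrite -/(w _) (wE (f 0%N)) /= ltnn.
Qed.

Definition pos S := forall x, S x -> o 0 x /\ x <> 0.

(** A skipped letter is positive and strictly increases the sum, so equal sums leave no skipped
    letter and force equal letters. The equality case serves to bound the length of words of given
    sum. *)
Lemma emb_sum S v w : pos S -> word S w -> emb v w ->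
  o (\sum_(x <- v) x) (\sum_(x <- w) x) /\
  (\sum_(x <- v) x = \sum_(x <- w) x -> v = w).
Proof.
move=> pS + e; elim: e => {v w} [w|v b w _ IH|a b v w ab _ IH] wS.
- elim: w wS => [|x w IH] wS; first by split=> //; exact: tle_refl.
  have [|l _] := IH; first by move=> y yw; apply: wS; rewrite inE yw orbT.
  have [lx nx] := pS x (wS x (mem_head _ _)).
  rewrite big_nil in l *; rewrite big_cons; split.
    by rewrite -[X in o X _](addr0 0); exact: tle_add2.
  move=> E; case: nx; apply: tle_anti lx; rewrite [X in o _ X]E.
  by rewrite -[X in o X _]addr0; exact: tle_addl.
- have [|l E] := IH; first by move=> y yw; apply: wS; rewrite inE yw orbT.
  have [lb nb] := pS b (wS b (mem_head _ _)).
  rewrite big_cons; split; first by rewrite -[X in o X _]add0r; apply: tle_add2.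
  move=> E'; case: nb; apply: tle_anti lb; apply: (tle_addr2 (c := \sum_(x <- w) x)).
  by rewrite -E' add0r.
- have [|l E] := IH; first by move=> y yw; apply: wS; rewrite inE yw orbT.
  rewrite !big_cons; split; first exact: tle_add2.
  move=> E'; have ab' : a = b.
    apply: tle_anti ab _; apply: (tle_addr2 (c := \sum_(x <- v) x)).
    by rewrite E'; apply: tle_addl.
  by move: E'; rewrite ab' => /addrI/E->.
Qed.

Definition gen S : set A := [set c | exists2 w, word S w & c = \sum_(x <- w) x].

Lemma gen0 S : gen S 0.
Proof. by exists [::]; rewrite ?big_nil. Qed.

Lemma gen1 S x : S x -> gen S x.
Proof. by move=> Sx; exists [:: x]; rewrite ?big_seq1 // => y; rewrite inE => /eqP->. Qed.

Lemma genD S x y : gen S x -> gen S y -> gen S (x + y).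
Proof.
move=> [v vS ->] [w wS ->]; exists (v ++ w); last by rewrite big_cat.
by move=> z; rewrite mem_cat => /orP[/vS|/wS].
Qed.

Lemma wo_gen S : wo o S -> pos S -> wo o (gen S).
Proof.
move=> wS pS; apply: wo_good_seq => s sP.
have /choice[w wP] i : exists w, word S w /\ s i = \sum_(x <- w) x.
  by have [w ? ?] := sP i; exists w.
have [|i [j [ij e]]] := higman wS (s := w); first by move=> i; case: (wP i).
exists i, j; split=> //; rewrite (wP i).2 (wP j).2.
by case: (emb_sum pS (wP j).1 e).
Qed.

(** Otherwise there are words with sum [c] of strictly increasing length; Higman's lemma embeds one
    in a later one, and equality of the sums makes them equal, against their lengths. *)
Lemma word_size_bound S c : wo o S -> pos S ->
  exists N, forall w, word S w -> c = \sum_(x <- w) x -> (size w < N)%N.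
Proof.
move=> wS pS; apply: contrapT => /forallNP unb.
have /choice[W hW] N : exists w : seq A,
    [/\ word S w, c = \sum_(x <- w) x & (N <= size w)%N].
  apply: contrapT => /forallNP nw; apply: (unb N) => w wS' wc.
  by rewrite ltnNge; apply/negP => Nw; apply: (nw w).
pose f := fix f k := if k is k'.+1 then (size (W (f k'))).+1 else 0%N.
have sf : {homo (fun i => size (W (f i))) : i j / (i < j)%N}.
  apply: homo_ltn => [|i]; first exact: ltn_trans.
  by case: (hW (f i.+1)).
have [|i [j [ij e]]] := higman wS (s := fun i => W (f i)).
  by move=> i; case: (hW (f i)).
have [wi ci _] := hW (f i); have [wj cj _] := hW (f j).
have [_ E] := emb_sum pS wj e.
by have := sf _ _ ij; rewrite /= E ?ltnn // -ci -cj.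
Qed.

End WellOrder.

(** * The ring of Hahn series *)

Section Fsum.
Variables (V : zmodType) (I J : choiceType).

(** The value is 0 when infinitely many terms are nonzero, which is why [fsumE], [fsum_exchange] and
    [fsum_mulr] ask for a finite set containing the support. *)
Definition fsum (F : I -> V) : V := \sum_(i \in [set: I]) F i.

Lemma fsumE (X : {fset I}) (F : I -> V) :
  (forall i, F i != 0 -> i \in X) -> fsum F = \sum_(i <- X) F i.
Proof.
move=> FX; apply: fsbigTE => i; apply: contraNeq; exact: FX.
Qed.

Lemma eq_fsum (F F' : I -> V) : F =1 F' -> fsum F = fsum F'.
Proof. by move=> /funext->. Qed.

Lemma fsum0 (F : I -> V) : (forall i, F i = 0) -> fsum F = 0.
Proof. by move=> F0; apply: fsbig1. Qed.

Lemma fsum1 (i0 : I) (F : I -> V) : (forall i, i != i0 -> F i = 0) -> fsum F = F i0.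
Proof.
move=> F0; rewrite (fsumE (X := [fset i0]%fset)) ?big_seq_fset1 // => i.
by rewrite inE; apply: contraR => /F0->; rewrite eqxx.
Qed.

Lemma fsum_neq0 (F : I -> V) : fsum F != 0 -> exists i, F i != 0.
Proof.
by apply: contra_neqP => /forallNP F0; apply: fsum0 => i; apply/eqP/negPn/negP.
Qed.

Lemma finite_fset (P : set I) : finite_set P ->
  exists X : {fset I}, forall i, P i -> i \in X.
Proof.
by move=> fP; exists (fset_set P) => i Pi; rewrite in_fset_set // inE.
Qed.

Lemma fsum_exchange (F : I -> J -> V) (X : {fset I}) (Y : {fset J}) :
  (forall i j, F i j != 0 -> i \in X /\ j \in Y) ->
  fsum (fun i => \sum_(j \in [set: J]) F i j) =
  \sum_(j \in [set: J]) fsum (F^~ j).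
Proof.
move=> FXY.
have E1 i : \sum_(j \in [set: J]) F i j = \sum_(j <- Y) F i j.
  by apply: fsbigTE => j; apply: contraNeq => /FXY[].
have E2 j : fsum (F^~ j) = \sum_(i <- X) F i j by apply: fsumE => i /FXY[].
rewrite (eq_fsum E1) (fsumE (X := X)); last first.
  move=> i; apply: contraR => iX; rewrite big1_seq // => j _.
  by apply/eqP; apply: contraNT iX => /FXY[].
rewrite exchange_big /= (fsbigTE Y).
  by apply: eq_bigr => j _; rewrite E2.
move=> j jY; rewrite E2 big1 // => i _.
by apply/eqP; apply: contraNT jY => /FXY[].
Qed.

Lemma fsum_reindex (h : J -> I) (F : I -> V) : bijective h ->
  fsum F = \sum_(j \in [set: J]) F (h j).
Proof. exact: reindex_fsbigT. Qed.

End Fsum.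

Section FsumRing.
Variables (R : comNzRingType) (I : choiceType).

Lemma fsum_mulr (X : {fset I}) (F : I -> R) (r : R) :
  (forall i, F i != 0 -> i \in X) -> fsum F * r = fsum (fun i => F i * r).
Proof.
move=> FX; rewrite !(fsumE (X := X)) ?mulr_suml // => i.
by move=> Fr; apply: FX; apply: contraNneq Fr => ->; rewrite mul0r.
Qed.

End FsumRing.

(** * Convolution and the ring structure *)

Section Hahn.
Variables (R : comNzRingType) (A : zmodType) (o : toa A).
Implicit Types (f g h : A -> R).

Definition nz f : set A := [set a | f a != 0].
Definition conv f g : A -> R := fun c => fsum (fun a => f a * g (c - a)).

Lemma conv_neq0 f g c : conv f g c != 0 ->
  exists a, f a != 0 /\ g (c - a) != 0.
Proof.
move=> /fsum_neq0[a fg]; exists a; split; apply: contraNneq fg => ->.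
  by rewrite mul0r.
by rewrite mulr0.
Qed.

Lemma mulr_neq0P (x y : R) : x * y != 0 -> x != 0 /\ y != 0.
Proof.
by move=> xy; split; apply: contraNneq xy => ->; rewrite ?mul0r ?mulr0.
Qed.

Lemma conv_fset f g c : wo o (nz f) -> wo o (nz g) ->
  exists X : {fset A}, forall a, f a * g (c - a) != 0 -> a \in X.
Proof.
move=> wf wg; have [X XP] := finite_fset (finite_sum_pairs c wf wg).
by exists X => a /mulr_neq0P[fa ga]; apply: XP.
Qed.

Lemma wo_conv f g : wo o (nz f) -> wo o (nz g) -> wo o (nz (conv f g)).
Proof.
move=> wf wg; apply: wo_sub (wo_sumset wf wg) => c /conv_neq0[a [fa ga]].
by exists a, (c - a); split=> //; rewrite addrCA subrr addr0.
Qed.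

Lemma convC f g : conv f g = conv g f.
Proof.
apply/funext => c; rewrite /conv (fsum_reindex (h := fun a => c - a)).
  by apply: eq_fsum => a; rewrite subKr mulrC.
by exists (fun a => c - a) => a; rewrite subKr.
Qed.

Lemma convA f g h : wo o (nz f) -> wo o (nz g) -> wo o (nz h) ->
  conv f (conv g h) = conv (conv f g) h.
Proof.
move=> wf wg wh; apply/funext => c.
(* [d] is the sum of the exponents taken from [f] and [g]; in the variables [a], [d] both
   bracketings are iterated sums of the same terms. *)
pose T a d := f a * g (d - a) * h (c - d).
transitivity (fsum (fun a => \sum_(d \in [set: A]) T a d)).
  apply: eq_fsum => a; rewrite mulrC.
  have [X XP] := conv_fset (c - a) wg wh.
  rewrite (fsum_mulr _ XP) (fsum_reindex (h := fun d => d - a)); last first.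
    by exists (fun d => d + a) => d; rewrite ?subrK ?addrK.
  by apply: eq_fsum => d; rewrite /T opprB addrA subrK; ring.
have [X XP] := finite_fset (finite_sum_pairs c wf (wo_sumset wg wh)).
have [Y YP] := finite_fset (finite_sum_pairs c (wo_sumset wf wg) wh).
rewrite (fsum_exchange (X := X) (Y := Y)).
  apply: eq_fsum => d; have [Z ZP] := conv_fset d wf wg.
  by rewrite -(fsum_mulr _ ZP).
move=> a d /mulr_neq0P[/mulr_neq0P[fa gd] hd]; split.
  apply: XP; split=> //; exists (d - a), (c - d); split=> //.
  by rewrite [RHS]addrC addrA subrK.
by apply: YP; split=> //; exists a, (d - a); split=> //; rewrite addrCA subrr addr0.
Qed.

Record hahn := Hahn { hcoef :> A -> R; hcoefP : wo o (nz hcoef) }.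
Arguments hcoefP : clear implicits.

Lemma hahnP (x y : hahn) : (forall a, x a = y a) -> x = y.
Proof.
case: x y => [f fP] [g gP] /= /funext E; rewrite E in fP *.
by congr Hahn; exact: Prop_irrelevance.
Qed.

HB.instance Definition _ := gen_eqMixin hahn.
HB.instance Definition _ := gen_choiceMixin hahn.

Lemma wo_zero : wo o (nz (fun=> 0)).
Proof. by apply: wo_sub (@wo_set0 _ o) => a; rewrite /nz /= eqxx. Qed.

Lemma wo_mono (r : R) a : wo o (nz (fun c => if c == a then r else 0)).
Proof.
apply: wo_sub (@wo_set1 _ o a) => c; rewrite /nz /=.
by have [->|_] := eqVneq c a => //; rewrite eqxx.
Qed.

Lemma wo_nzD f g : wo o (nz f) -> wo o (nz g) -> wo o (nz (fun c => f c + g c)).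
Proof.
move=> wf wg; apply: wo_sub (wo_union wf wg) => a; rewrite /nz /=.
have [->|fa _] := eqVneq (f a) 0; last by left.
by rewrite add0r; right.
Qed.

Lemma wo_nzN f : wo o (nz f) -> wo o (nz (fun c => - f c)).
Proof. by apply: wo_sub => a; rewrite /nz /= oppr_eq0. Qed.

Definition mono (r : R) (a : A) : hahn := Hahn (@wo_mono r a).
Definition h0 : hahn := Hahn wo_zero.
Definition hplus (x y : hahn) : hahn := Hahn (wo_nzD (hcoefP x) (hcoefP y)).
Definition hopp (x : hahn) : hahn := Hahn (wo_nzN (hcoefP x)).
Definition hprod (x y : hahn) : hahn := Hahn (wo_conv (hcoefP x) (hcoefP y)).

Fact hplusA : associative hplus.
Proof. by move=> x y z; apply: hahnP => a /=; rewrite addrA. Qed.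
Fact hplusC : commutative hplus.
Proof. by move=> x y; apply: hahnP => a /=; rewrite addrC. Qed.
Fact hplus0 : left_id h0 hplus.
Proof. by move=> x; apply: hahnP => a /=; rewrite add0r. Qed.
Fact hplusN : left_inverse h0 hopp hplus.
Proof. by move=> x; apply: hahnP => a /=; rewrite addNr. Qed.

HB.instance Definition _ := GRing.isZmodule.Build hahn hplusA hplusC hplus0 hplusN.

Fact hprodA : associative hprod.
Proof.
move=> x y z; apply: hahnP => c /=.
by rewrite (convA (hcoefP x) (hcoefP y) (hcoefP z)).
Qed.
Fact hprodC : commutative hprod.
Proof. by move=> x y; apply: hahnP => c /=; rewrite convC. Qed.
Fact hprod1 : left_id (mono 1 0) hprod.
Proof.
move=> x; apply: hahnP => c /=; rewrite /conv (fsum1 (i0 := 0)) ?eqxx ?mul1r ?subr0 //.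
by move=> a /negPf->; rewrite mul0r.
Qed.
Fact hprodDl : left_distributive hprod hplus.
Proof.
move=> x y z; apply: hahnP => c /=; rewrite /conv.
have [X XP] := conv_fset c (hcoefP x) (hcoefP z).
have [Y YP] := conv_fset c (hcoefP y) (hcoefP z).
rewrite !(fsumE (X := (X `|` Y)%fset)) -?big_split /=.
- by apply: eq_bigr => a _; rewrite mulrDl.
- by move=> a /YP; rewrite inE orbC => ->.
- by move=> a /XP; rewrite inE => ->.
move=> a; rewrite inE mulrDl; apply: contraR; rewrite negb_or => /andP[aX aY].
rewrite (eqP (contraNT (XP a) aX)) (eqP (contraNT (YP a) aY)).
by rewrite addr0 eqxx.
Qed.
Fact hone_neq0 : mono 1 0 != 0 :> hahn.
Proof.
apply/eqP => /(congr1 (fun x : hahn => x 0)) /=; rewrite eqxx => /eqP.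
by rewrite oner_eq0.
Qed.

HB.instance Definition _ := GRing.Zmodule_isComNzRing.Build hahn
  hprodA hprodC hprod1 hprodDl hone_neq0.

Lemma hcoefD (x y : hahn) a : (x + y) a = x a + y a. Proof. by []. Qed.
Lemma hcoefN (x : hahn) a : (- x) a = - x a. Proof. by []. Qed.
Lemma hcoefM (x y : hahn) a : (x * y) a = conv x y a. Proof. by []. Qed.
Lemma hcoef1 a : (1 : hahn) a = (a == 0)%:R. Proof. by rewrite /= ; case: eqP. Qed.

Lemma hcoef_sum (I : Type) (r : seq I) (P : pred I) (F : I -> hahn) a :
  (\sum_(i <- r | P i) F i) a = \sum_(i <- r | P i) F i a.
Proof. by elim/big_rec2: _ => // i y1 y2 _ <-. Qed.

Lemma hcoefMn (x : hahn) m a : (x *+ m) a = x a *+ m.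
Proof. by elim: m => [|m IH]; rewrite ?mulr0n // !mulrS -IH. Qed.

Lemma hcoefMz (x : hahn) (m : int) a : (x *~ m) a = x a *~ m.
Proof. by case: m => m; rewrite ?NegzE ?mulrNz ?hcoefN -!pmulrn hcoefMn. Qed.

Lemma mono10 : mono 1 0 = 1. Proof. by []. Qed.

Lemma monoM_coef (r : R) a (x : hahn) c : (mono r a * x) c = r * x (c - a).
Proof.
rewrite hcoefM /conv (fsum1 (i0 := a)) /= ?eqxx // => b /negPf->.
by rewrite mul0r.
Qed.

Lemma monoM (r s : R) a b : mono r a * mono s b = mono (r * s) (a + b).
Proof.
apply: hahnP => c; rewrite monoM_coef /= subr_eq [b + a]addrC.
by case: eqP; rewrite ?mulr0.
Qed.

Lemma hcoefM_sub (S : set A) (x y : hahn) :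
  (forall a b, S a -> S b -> S (a + b)) ->
  nz x `<=` S -> nz y `<=` S -> nz (x * y) `<=` S.
Proof.
move=> SD xS yS c /conv_neq0[a [xa ya]].
by rewrite -(subrK a c) addrC; apply: SD; [exact: xS | exact: yS].
Qed.

Lemma expr_word (S : set A) (x : hahn) m c : nz x `<=` S -> (x ^+ m) c != 0 ->
  exists w, [/\ word S w, size w = m & c = \sum_(y <- w) y].
Proof.
move=> xS; elim: m c => [|m IH] c.
  rewrite expr0 hcoef1; have [->|] := eqVneq c 0; rewrite ?eqxx // => _.
  by exists [::]; rewrite big_nil.
rewrite exprS => /conv_neq0[a [xa /IH[w [wS sw E]]]]; exists (a :: w).
rewrite /= sw big_cons -E addrCA subrr addr0; split=> // y.
by rewrite inE => /orP[/eqP->|/wS//]; exact: xS.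
Qed.

(** A nonzero coefficient at [c] writes [c] as a sum of [m] exponents of the positive support, and
    the length of such words is bounded. *)
Lemma expr_vanish (x : hahn) c : pos o (nz x) ->
  exists N, forall m, (N <= m)%N -> (x ^+ m) c = 0.
Proof.
move=> px; have [N NP] := word_size_bound c (hcoefP x) px.
exists N => m Nm; apply/eqP; apply: contraTT Nm => /(expr_word (@subset_refl _ _)).
by move=> [w [wS <- E]]; rewrite -ltnNge; exact: NP.
Qed.

Lemma expr_vanish_fset (x : hahn) (X : {fset A}) : pos o (nz x) ->
  exists N, forall m c, c \in X -> (N <= m)%N -> (x ^+ m) c = 0.
Proof.
move=> px; have [B BP] := choice (fun c => expr_vanish c px).
exists (\max_(c <- X) B c)%N => m c cX Nm; apply: BP; apply: leq_trans Nm.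
by rewrite (big_rem c) //= leq_maxl.
Qed.

(** Only finitely many exponents of the monoid generated by the support of [x] can contribute at
    [c], so one bound serves for all of them. *)
Lemma expr_mul_vanish (x y : hahn) c : pos o (nz x) ->
  exists N, forall m, (N <= m)%N -> (x ^+ m * y) c = 0.
Proof.
move=> px.
have [X XP] := finite_fset (finite_sum_pairs c (wo_gen (hcoefP x) px) (hcoefP y)).
have [N NP] := expr_vanish_fset X px; exists N => m Nm.
apply: fsum0 => a; apply/eqP; apply: contraT => /mulr_neq0P[xa ya].
have aX : a \in X.
  apply: XP; split=> //.
  by have [w [wS _ ->]] := expr_word (@subset_refl _ _) xa; exists w.
by move: xa; rewrite NP // eqxx.
Qed.

(* The inverse is the geometric series [sum_m (-x)^m], which is pointwise finite. *)
Lemma inv1p (x : hahn) : pos o (nz x) ->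
  exists2 y : hahn, (1 + x) * y = 1 & nz y `<=` gen (nz x).
Proof.
move=> px.
have pNx : pos o (nz (- x)) by move=> a; rewrite /nz /= oppr_eq0; exact: px.
have nzN : nz (- x) `<=` nz x by move=> a; rewrite /nz /= oppr_eq0.
have [B BP] := choice (fun c => expr_vanish c pNx).
pose s N : hahn := \sum_(m < N) (- x) ^+ m.
(* The coefficient at [c] of the partial sums is stationary from [B c] on; [v] collects the
   limits. *)
pose v c := s (B c) c.
have vE N c : (B c <= N)%N -> s N c = v c.
  move=> BN; rewrite /v /s !hcoef_sum [RHS](big_ord_widen N (fun m => ((- x) ^+ m) c)) //.
  rewrite [RHS]big_mkcond /=; apply: eq_bigr => i _; case: ltnP => // Bi.
  exact: BP.
have vg : nz v `<=` gen (nz x).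
  move=> c; rewrite /nz /= /v /s hcoef_sum => sc.
  have [m mP] : exists m : 'I_(B c), ((- x) ^+ m) c != 0.
    apply: contrapT => /forallNP z; move: sc; rewrite big1 ?eqxx // => i _.
    by apply/eqP/negPn/negP.
  by have [w [wS _ ->]] := expr_word nzN mP; exists w.
pose y := Hahn (wo_sub vg (wo_gen (hcoefP x) px)).
exists y => //; apply: hahnP => c.
have w1x := hcoefP (1 + x).
have [X XP] := finite_fset (finite_sum_pairs c w1x (wo_gen (hcoefP x) px)).
(* For this [N] the partial sum agrees with [y] at each [c - a] that can contribute, and the
   remainder [(- x) ^+ N] vanishes at [c]. *)
pose N := maxn (B c) (\max_(a <- X) B (c - a)%R)%N.
have -> : ((1 + x) * y) c = ((1 + x) * s N) c.
  rewrite !hcoefM /conv; apply: eq_fsum => a.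
  have [->|xa] := eqVneq ((1 + x) a) 0; first by rewrite !mul0r.
  case: (pselect (gen (nz x) (c - a))) => ga.
    have aX := XP a (conj xa ga); rewrite /= vE //.
    apply: leq_trans (leq_maxr _ _).
    by rewrite (big_rem a) //= leq_maxl.
  rewrite (_ : s N (c - a) = 0) /=.
    by congr (_ * _); apply/eqP; apply: contra_notT ga => /vg.
  rewrite /s hcoef_sum big1 // => i _; apply/eqP; apply: contra_notT ga => iP.
  by have [w [wS _ ->]] := expr_word nzN iP; exists w.
have -> : (1 + x) * s N = 1 - (- x) ^+ N 
  by rewrite -[RHS]opprB subrX1 -mulNr opprB opprK.
by rewrite hcoefD hcoefN BP ?leq_maxl // subr0.
Qed.

End Hahn.
Arguments hcoefP {R A o} h.
Arguments mono {R A o} r a.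

(** * Determinants of closed one-forms *)

Section Minors.
Variables (H : comNzRingType) (n : nat).
Implicit Types (v M : 'M[H]_n).

(** [M] and [v] share the cofactors of row [i0], and [v *m \adj v] is the scalar matrix of [\det v],
    so only the term [i = i0] survives. *)
Lemma det_row_comb v M (x : 'I_n -> H) i0 :
  (forall i j, i != i0 -> M i j = v i j) ->
  (forall j, M i0 j = \sum_i x i * v i j) -> \det M = x i0 * \det v.
Proof.
move=> Mv M0; rewrite (expand_det_row M i0).
have cofE j : cofactor M i0 j = cofactor v i0 j.
  rewrite /cofactor; congr (_ * \det _); apply/matrixP => i k.
  by rewrite !mxE Mv // eq_sym neq_lift.
transitivity (\sum_i x i * (v *m \adj v) i i0).
  under eq_bigr do rewrite M0 cofE mulr_suml.
  rewrite exchange_big /=; apply: eq_bigr => i _; rewrite mxE mulr_sumr.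
  by apply: eq_bigr => j _; rewrite !mxE mulrA.
rewrite mul_mx_adj (bigD1 i0) //= mxE eqxx mulr1n big1 ?addr0 // => i /negPf ni.
by rewrite mxE ni mulr0n mulr0.
Qed.

Lemma det_row_scale v M (x : H) i0 :
  (forall i j, i != i0 -> M i j = v i j) ->
  (forall j, M i0 j = x * v i0 j) -> \det M = x * \det v.
Proof.
move=> Mv M0.
rewrite (det_row_comb (x := fun i => if i == i0 then x else 0) Mv) ?eqxx // => j.
rewrite (bigD1 i0) //= eqxx big1 ?addr0 // => i /negPf->.
by rewrite mul0r.
Qed.

Variables (D : 'I_n -> {additive H -> H}).
Hypothesis DM : forall j x y, D j (x * y) = D j x * y + x * D j y.
Hypothesis H2 : forall x : H, x = - x -> x = 0.

Lemma deriv1 j : D j 1 = 0.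
Proof.
have := DM j 1 1; rewrite !mulr1 mul1r => /eqP.
by rewrite -subr_eq0 opprD addNKr oppr_eq0 => /eqP.
Qed.

Lemma deriv_prod j (r : seq 'I_n) (P : pred 'I_n) (f : 'I_n -> H) : uniq r ->
  D j (\prod_(i <- r | P i) f i) =
  \sum_(i <- r | P i) D j (f i) * \prod_(i' <- r | P i' && (i' != i)) f i'.
Proof.
elim: r => [|a r IH] /=; first by rewrite !big_nil deriv1.
move=> /andP[ar ur]; rewrite big_cons [RHS]big_cons.
have E0 : \prod_(i' <- a :: r | P i' && (i' != a)) f i' = \prod_(i' <- r | P i') f i'.
  rewrite big_cons eqxx andbF big_seq_cond [RHS]big_seq_cond.
  apply: eq_bigl => i; case ir: (i \in r) => //=; case: (P i) => //=.
  by apply: contraNneq ar => <-.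
have E1 i : i \in r -> \prod_(i' <- a :: r | P i' && (i' != i)) f i' =
    (if P a then f a else 1) * \prod_(i' <- r | P i' && (i' != i)) f i'.
  move=> ir; rewrite big_cons; have -> : a != i by apply: contraNneq ar => ->.
  by rewrite andbT; case: (P a); rewrite ?mul1r.
case Pa: (P a); last first.
  rewrite IH // big_seq_cond [RHS]big_seq_cond; apply: eq_bigr => i /andP[ir _].
  by rewrite E1 // Pa mul1r.
rewrite DM E0 IH //; congr (_ + _); rewrite mulr_sumr.
rewrite big_seq_cond [RHS]big_seq_cond; apply: eq_bigr => i /andP[ir _].
by rewrite E1 // Pa mulrCA.
Qed.

Lemma deriv_sign j (b : bool) x : D j ((-1) ^+ b * x) = (-1) ^+ b * D j x.
Proof. by rewrite !mulr_sign; case: b; rewrite ?raddfN. Qed.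

(* Exchanging [s i0] and [s i1] flips the sign of each second-order term. *)
Lemma div_cofactor M i0 :
  (forall i j k, i != i0 -> D j (M i k) = D k (M i j)) ->
  \sum_(s : 'S_n) (-1) ^+ s * D (s i0) (\prod_(i | i != i0) M i (s i)) = 0.
Proof.
move=> cl.
pose T (s : 'S_n) i1 := (-1) ^+ s * (D (s i0) (M i1 (s i1)) *
  \prod_(i | (i != i0) && (i != i1)) M i (s i)).
transitivity (\sum_(s : 'S_n) \sum_(i1 | i1 != i0) T s i1).
  apply: eq_bigr => s _; rewrite deriv_prod ?index_enum_uniq // mulr_sumr.
  exact: eq_bigr.
rewrite exchange_big big1 // => i1 ni1; apply: H2.
rewrite [LHS](reindex_inj (mulgI (tperm i0 i1))) /= -sumrN; apply: eq_bigr => s _.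
rewrite /T odd_permM odd_tperm eq_sym ni1 signr_addb !permM tpermL tpermR.
rewrite mulN1r mulNr cl //; congr (- (_ * (_ * _))); apply: eq_bigr => i /andP[n0 n1].
by rewrite permM tpermD // eq_sym.
Qed.

(** In the permutation expansion of [\det M], moving the derivation from [h] to the whole product
    costs [h] times the sum in [div_cofactor], which is 0. *)
Lemma det_exact_row M i0 (h : H) :
  (forall i j k, i != i0 -> D j (M i k) = D k (M i j)) ->
  (forall j, M i0 j = D j h) ->
  exists W : 'S_n -> H, \det M = \sum_(s : 'S_n) D (s i0) (W s).
Proof.
move=> cl M0.
exists (fun s : 'S_n => (-1) ^+ s * (h * \prod_(i | i != i0) M i (s i))).
under [RHS]eq_bigr do rewrite deriv_sign DM mulrDr [(-1) ^+ _ * (h * _)]mulrCA.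
rewrite big_split /= -mulr_sumr (div_cofactor cl) mulr0 addr0 /determinant.
by apply: eq_bigr => s _; rewrite (bigD1 i0) //= M0.
Qed.

End Minors.

(** * Integer powers and their derivatives *)

Section ZPow.
Variable H : comNzRingType.
Implicit Types (x y : H) (z : int).

(* [y] plays the role of the inverse of [x]. *)
Definition zpow x y z : H :=
  match z with Posz m => x ^+ m | Negz m => y ^+ m.+1 end.

Lemma zpowM x y x' y' z : zpow (x * x') (y * y') z = zpow x y z * zpow x' y' z.
Proof. by case: z => m; rewrite /= exprMn. Qed.

Lemma zpowS x y z : x * y = 1 -> zpow x y (z + 1) = zpow x y z * x.
Proof.
move=> xy; case: z => m.
  by rewrite -PoszD addn1 /= exprSr.
case: m => [|m]; first by rewrite /= expr1 mulrC xy.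
have -> : Negz m.+1 + 1 = Negz m by lia.
by rewrite /= [y ^+ m.+2]exprSr -mulrA [y * x]mulrC xy mulr1.
Qed.

Variable D : {additive H -> H}.
Hypothesis DM : forall x y, D (x * y) = D x * y + x * D y.

Lemma deriv_exp x y m : x * y = 1 -> D (x ^+ m) = x ^+ m * (D x * y) *+ m.
Proof.
move=> xy; elim: m => [|m IH].
  have := DM 1 1; rewrite !mulr1 mul1r expr0 mulr0n => /eqP.
  by rewrite -subr_eq0 opprD addNKr oppr_eq0 => /eqP.
rewrite exprS DM IH mulrS mulrnAr mulrA; congr (_ + _).
by rewrite -[LHS]mulr1 -xy; ring.
Qed.

Lemma deriv_inv x y : x * y = 1 -> D y = - (D x * y) * y.
Proof.
move=> xy; have := DM x y; rewrite xy.
have -> : D 1 = 0 by rewrite -(expr0 1) (deriv_exp _ (mulr1 1)) mulr0n.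
move=> /esym/eqP; rewrite addrC addr_eq0 => /eqP/(congr1 ( *%R^~ y)).
by rewrite mulrAC xy mul1r.
Qed.

Lemma deriv_zpow x y z : x * y = 1 ->
  D (zpow x y z) = zpow x y z * (D x * y) *~ z.
Proof.
move=> xy; case: z => m /=; first exact: deriv_exp.
rewrite (@deriv_exp y x) 1?mulrC // (deriv_inv xy) NegzE mulrNz -pmulrn.
have -> : - (D x * y) * y * x = - (D x * y) by rewrite -mulrA [y * x]mulrC xy mulr1.
by rewrite mulNr mulNrn [D x * y * _]mulrC.
Qed.

End ZPow.

(** * Logarithmic derivations of Hahn series *)

Section Theta.
Variables (R : comNzRingType) (A : zmodType) (o : toa A).
Local Notation H := (hahn R o).
Implicit Types (l : {additive A -> int}) (x y : H).

Lemma wo_theta l x : wo o (nz (fun c => x c *~ l c)).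
Proof.
apply: wo_sub (hcoefP x) => c; rewrite /nz /=.
by apply: contraNneq => ->; rewrite mul0rz.
Qed.

(** The Euler derivation [t^c |-> l(c) t^c]; for [l] the exponent of [x_j] it is [x_j] times the
    partial derivative in [x_j], and it does not shift exponents. *)
Definition theta l x : H := Hahn (@wo_theta l x).

Fact theta_additive l : zmod_morphism (theta l).
Proof. by move=> x y; apply: hahnP => c /=; rewrite mulrzBl. Qed.
HB.instance Definition _ l := GRing.isZmodMorphism.Build H H (theta l) (theta_additive l).

Lemma thetaM l x y : theta l (x * y) = theta l x * y + x * theta l y.
Proof.
apply: hahnP => c; rewrite hcoefD !hcoefM /= /conv /=.
have [X XP] := conv_fset c (hcoefP x) (hcoefP y).
rewrite (fsumE XP) !(fsumE (X := X)).
- rewrite -big_split mulrz_suml /=; apply: eq_bigr => a _.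
  have -> : l c = l a + l (c - a) by rewrite -raddfD addrC subrK.
  by rewrite mulrzDr mulrzAl mulrzAr.
- by move=> a; rewrite mulrzAr => xa; apply: XP; apply: contraNneq xa => ->; rewrite mul0rz.
- by move=> a; rewrite mulrzAl => xa; apply: XP; apply: contraNneq xa => ->; rewrite mul0rz.
Qed.

Lemma thetaC l l' x : theta l (theta l' x) = theta l' (theta l x).
Proof. by apply: hahnP => c /=; rewrite mulrzAC. Qed.

Lemma theta_mono l (r : R) a : theta l (mono r a) = mono r a *~ l a.
Proof.
apply: hahnP => c; rewrite hcoefMz /=; case: eqP => [->//|_].
by rewrite !mul0rz.
Qed.

Lemma theta1 l : theta l 1 = 0.
Proof. by rewrite -mono10 theta_mono raddf0 mulr0z. Qed.

Lemma theta_int l (m : int) : theta l (m%:~R) = 0.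
Proof. by rewrite raddfMz /= theta1 mul0rz. Qed.

(** Logarithmic differentials are closed: the derivations commute, and the remaining quadratic term
    is symmetric in [l] and [l']. *)
Lemma theta_closed l l' x y : x * y = 1 ->
  theta l (theta l' x * y) = theta l' (theta l x * y).
Proof.
move=> xy; rewrite !thetaM !(deriv_inv (thetaM _) xy) thetaC.
by congr (_ + _); ring.
Qed.

End Theta.

(** * The residue formula for monomials, over a torsion-free ring *)

Section Core.
Variables (R : comNzRingType) (A : zmodType) (o : toa A) (n : nat).
Local Notation H := (hahn R o).
Variable l : 'I_n -> {additive A -> int}.
Variables (a : 'I_n -> A) (tau y : 'I_n -> H).
Hypothesis tau_pos : forall i, pos o (nz (tau i)).
Let u i := 1 + tau i.
Hypothesis uy : forall i, u i * y i = 1.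

Definition expmat : 'M[int]_n := \matrix_(i, j) l j (a i).

Definition dlog (i j : 'I_n) : H := theta (l j) (u i) * y i.

(** The logarithmic Jacobian matrix of the series [t^(a_i) (1 + tau_i)]: the integer part comes from
    the initial monomials, [dlog] from the unit factors. *)
Definition ldlog : 'M[H]_n := \matrix_(i, j) ((expmat i j)%:~R + dlog i j).

Definition mpow (k : 'rV[int]_n) : H :=
  mono 1 (\sum_i a i *~ k 0 i) * \prod_i zpow (u i) (y i) (k 0 i).

Lemma dlog_closed i j k : theta (l j) (dlog i k) = theta (l k) (dlog i j).
Proof. exact: theta_closed. Qed.

Lemma ldlog_closed i j k : theta (l j) (ldlog i k) = theta (l k) (ldlog i j).
Proof. by rewrite !mxE !raddfD /= !theta_int dlog_closed. Qed.

Lemma theta_mpow k j :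
  theta (l j) (mpow k) = \sum_i (mpow k *~ k 0 i) * ldlog i j.
Proof.
rewrite /mpow thetaM theta_mono.
rewrite (deriv_prod (D := fun j => theta (l j)) (fun j => @thetaM _ _ _ (l j)))
  ?index_enum_uniq //=.
set m := mono 1 _; set P := \prod_i _.
have -> : \sum_i theta (l j) (zpow (u i) (y i) (k 0 i)) *
    \prod_(i' | i' != i) zpow (u i') (y i') (k 0 i') =
    \sum_i (P * dlog i j) *~ k 0 i.
  apply: eq_bigr => i _; rewrite (deriv_zpow (thetaM _) _ (uy i)).
  by rewrite /P [in RHS](bigD1 i) //= mulrzAl mulrAC.
rewrite raddf_sum /= mulrz_sumr mulr_suml mulr_sumr -big_split /=.
apply: eq_bigr => i _; rewrite raddfMz /= mxE mulrDr [expmat _ _]mxE.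
rewrite mulrzz mulrzA !mulrzAl [m * (_ *~ _)]mulrzAr mulrA.
by rewrite [m * P * _ in RHS]mulrzAr mulr1.
Qed.

Hypothesis torsfree : forall (x : R) (m : int), m != 0 -> x *~ m = 0 -> x = 0.

Lemma hahn_eq_opp (x : H) : x = - x -> x = 0.
Proof.
move=> E; apply: hahnP => b; apply: (torsfree (m := 2)) => //.
have /eqP := congr1 (fun z : H => z b) E.
by rewrite /= -addr_eq0 => /eqP.
Qed.

Variable c : A.
Hypothesis lc : forall j, l j c = 0.

(** The exponent [c] is killed by all [l j], so it lies inside the constant term in [x]; each
    [theta (l j)] has coefficient 0 there, hence so does a divergence. *)
Lemma coef_det_exact (M : 'M[H]_n) i0 (h : H) :
  (forall i j k, i != i0 -> theta (l j) (M i k) = theta (l k) (M i j)) ->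
  (forall j, M i0 j = theta (l j) h) -> (\det M) c = 0.
Proof.
move=> cl M0.
have [W ->] := det_exact_row (D := fun j => theta (l j))
  (fun j => @thetaM _ _ _ (l j)) hahn_eq_opp cl M0.
by rewrite hcoef_sum big1 // => s _ /=; rewrite lc mulr0z.
Qed.

Lemma coef_mpow_ldlog k : k != 0 -> (mpow k * \det ldlog) c = 0.
Proof.
move=> nk; have [i0 ki0] : exists i, k 0 i != 0.
  apply: contrapT => /forallNP k0; case/eqP: nk; apply/rowP => i; rewrite mxE.
  by apply/eqP/negPn/negP.
apply: (torsfree ki0); rewrite -hcoefMz -mulrzAl.
(* By [theta_mpow] the new row combines the rows of [ldlog] with weights [k_i F^k], so the
   determinant picks up the factor [k_i0 F^k]. *)
pose M := \matrix_(i, j) if i == i0 then theta (l j) (mpow k) else ldlog i j.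
rewrite -(det_row_comb (x := fun i => mpow k *~ k 0 i) (M := M) (i0 := i0)).
- apply: (coef_det_exact (i0 := i0) (h := mpow k)) => [i j j'|j].
    by rewrite ![M _ _]mxE => /negPf->; exact: ldlog_closed.
  by rewrite mxE eqxx.
- by move=> i j /negPf ni; rewrite mxE ni.
- by move=> j; rewrite mxE eqxx theta_mpow.
Qed.

(* With [s = - tau], [(m + 1) s^m u det M] is the determinant whose exact row is
   [d (- s^(m+1))], so [s^m det M] and [s^(m+1) det M] have the same coefficient. *)
Lemma coef_det_dlog (M : 'M[H]_n) i0 :
  (forall i j k, i != i0 -> theta (l j) (M i k) = theta (l k) (M i j)) ->
  (forall j, M i0 j = dlog i0 j) -> (\det M) c = 0.
Proof.
move=> cl M0; pose s := - tau i0.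
have us : u i0 = 1 - s by rewrite /u opprK.
have ps : pos o (nz s) by move=> b; rewrite /nz /= oppr_eq0; exact: tau_pos.
have step m : (s ^+ m * \det M) c = (s ^+ m.+1 * \det M) c.
  apply/eqP; rewrite -subr_eq0 -hcoefN -hcoefD -mulrBl exprSr.
  rewrite -{1}[s ^+ m]mulr1 -mulrBr -us; apply/eqP.
  apply: (torsfree (m := m.+1)) => //; rewrite -hcoefMz -mulrzAl.
  pose N := \matrix_(i, j) if i == i0 then theta (l j) (- s ^+ m.+1) else M i j.
  rewrite -(det_row_scale (v := M) (M := N) (i0 := i0)).
  - apply: (coef_det_exact (i0 := i0) (h := - s ^+ m.+1)) => [i j j' ni|j].
      by rewrite ![N _ _]mxE (negPf ni); exact: cl.
    by rewrite mxE eqxx.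
  - by move=> i j /negPf ni; rewrite mxE ni.
  - move=> j; rewrite mxE eqxx M0 /dlog raddfN /=.
    have -> : theta (l j) (u i0) = - theta (l j) s.
      by rewrite us raddfB /= theta1 sub0r.
    have -> : theta (l j) (s ^+ m.+1) = (s ^+ m * theta (l j) s) *+ m.+1.
      elim: (m) => [|p IH]; first by rewrite expr1 expr0 mul1r.
      rewrite exprS thetaM IH [in RHS]mulrS mulrnAr mulrA -exprS; congr (_ + _).
      by rewrite mulrC.
    rewrite mulrzAl -pmulrn -mulNrn; congr (_ *+ _).
    by rewrite -mulrN -{1}[- theta _ _]mulr1 -(uy i0); ring.
(* For large [N] the product [s ^+ N * \det M] has coefficient 0 at [c], and [step] carries this
   back down to the exponent 0. *)
have [N NP] := expr_mul_vanish (\det M) c ps.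
rewrite -[\det M]mul1r -(expr0 s); transitivity ((s ^+ N * \det M) c).
  by elim: (N) => // m ->; exact: step.
exact: NP.
Qed.

Lemma coef_ldlog : (\det ldlog) c = (\det expmat)%:~R * (c == 0)%:R.
Proof.
(* [V m] has its first [m] rows replaced by those of the initial monomials. *)
pose V m := \matrix_(i < n, j < n)
  ((expmat i j)%:~R + if (i < m)%N then 0 else dlog i j) : 'M[H]_n.
have V0 : ldlog = V 0%N by apply/matrixP => i j; rewrite !mxE.
have Vcl m i j k : theta (l j) (V m i k) = theta (l k) (V m i j).
  rewrite !mxE !raddfD /= !theta_int; case: ifP => _; rewrite ?raddf0 //.
  by rewrite dlog_closed.
have step (i0 : 'I_n) : (\det (V i0)) c = (\det (V i0.+1)) c.
  (* By linearity in row [i0], passing from [V i0] to [V i0.+1] costs the determinant with row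
     [dlog i0], whose coefficient at [c] vanishes. *)
  pose C := \matrix_(i, j) if i == i0 then dlog i0 j else V i0 i j.
  have -> : \det (V i0) = 1 * \det (V i0.+1) + 1 * \det C.
    apply: (determinant_multilinear (i0 := i0)).
    - apply/rowP => j; rewrite !mxE ltnn ltnSn eqxx !mul1r addr0.
      by [].
    - apply/matrixP => i j; rewrite !mxE; congr (_ + _).
      by rewrite ltnS leq_eqVlt (inj_eq val_inj) eq_sym (negPf (neq_lift _ _)).
    - by apply/matrixP => i j; rewrite !mxE eq_sym (negPf (neq_lift _ _)).
  rewrite !mul1r hcoefD (@coef_det_dlog C i0) ?addr0 //.
    by move=> i j k /negPf ni; rewrite ![C _ _]mxE ni.
  by move=> j; rewrite mxE eqxx.
have all m : (m <= n)%N -> (\det ldlog) c = (\det (V m)) c.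
  elim: m => [|m IH] mn; first by rewrite V0.
  by rewrite IH 1?ltnW // (step (Ordinal mn)).
rewrite (all n) //; have -> : V n = map_mx intr expmat.
  by apply/matrixP => i j; rewrite !mxE ltn_ord addr0.
by rewrite det_map_mx hcoefMz hcoef1 mulrzl.
Qed.

Lemma coef_core k :
  (mpow k * \det ldlog) c = if k == 0 then (\det expmat)%:~R * (c == 0)%:R else 0.
Proof.
case: eqVneq => [->|]; last exact: coef_mpow_ldlog.
rewrite -coef_ldlog /mpow big1 => [|i _]; last by rewrite mxE mulr0z.
by rewrite big1 ?mulr1 ?mono10 ?mul1r // => i _; rewrite mxE.
Qed.

End Core.

(** * Transfer to an arbitrary field *)

Section FreeRing.
Variable K : fieldType.

Local Notation W := {malg int[{cmonom K}]}.

Definition cm_eval (m : {cmonom K}) : K := \prod_(x <- finsupp m) x ^+ m x.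

Lemma cm_evalEw (d : {fset K}) (m : {cmonom K}) : (finsupp m `<=` d)%fset ->
  cm_eval m = \prod_(x <- d) x ^+ m x.
Proof.
move=> md; rewrite /cm_eval (big_fset_incl _ md) // => x _.
by rewrite -cmE_eq0 => /eqP->; rewrite expr0.
Qed.

Fact cm_eval_mmorphism : mmorphism cm_eval.
Proof.
split=> [m1 m2|]; last by rewrite /cm_eval mdom1 big_seq_fset0.
have dM := mdomD m1 m2.
rewrite (@cm_evalEw (finsupp (mmul m1 m2)) m1) ?dM ?fsubsetUl //.
rewrite (@cm_evalEw (finsupp m1 `|` finsupp m2)%fset m2) ?fsubsetUr //.
rewrite /cm_eval dM -big_split; apply: eq_bigr => x _ /=.
by rewrite cmM exprD.
Qed.
HB.instance Definition _ :=
  isMultiplicative.Build {cmonom K} K cm_eval cm_eval_mmorphism.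

Definition wproj : {rmorphism W -> K} := mmap (intr : int -> K) cm_eval.

(** Zero is lifted to 0 and not to its variable, so that lifting coefficients leaves supports
    unchanged. *)
Definition wlift (x : K) : W := if x == 0 then 0 else mkmalgU (ucm x) 1.

Lemma wliftK : cancel wlift wproj.
Proof.
move=> x; rewrite /wlift; case: eqVneq => [->|_]; first exact: rmorph0.
by rewrite /wproj /= mmapU mul1r /cm_eval mdomU big_seq_fset1 cmUU expr1.
Qed.

Lemma wtorsfree (w : W) (m : int) : m != 0 -> w *~ m = 0 -> w = 0.
Proof.
move=> nm E; apply/malgP => k; apply/eqP; rewrite mcoeff0.
have /eqP := congr1 (mcoeff k) E; rewrite raddfMz /= mcoeff0 mulrz_eq0.
by rewrite (negPf nm) /= => ->.
Qed.

End FreeRing.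

(** * Change of coefficient ring *)

Section HMap.
Variables (R R' : comNzRingType) (phi : {rmorphism R -> R'}).
Variables (A : zmodType) (o : toa A).

Lemma wo_hmap (x : hahn R o) : wo o (nz (fun c => phi (x c))).
Proof.
apply: wo_sub (hcoefP x) => c; rewrite /nz /=.
by apply: contraNneq => ->; rewrite rmorph0.
Qed.

Definition hmap (x : hahn R o) : hahn R' o := Hahn (@wo_hmap x).

Fact hmap_additive : zmod_morphism hmap.
Proof. by move=> x y; apply: hahnP => c /=; rewrite rmorphB. Qed.
HB.instance Definition _ :=
  GRing.isZmodMorphism.Build (hahn R o) (hahn R' o) hmap hmap_additive.

Lemma hmap_mono r a : hmap (mono r a) = mono (phi r) a.
Proof. by apply: hahnP => c /=; case: eqP; rewrite ?rmorph0. Qed.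

Fact hmap_multiplicative : monoid_morphism hmap.
Proof.
split=> [|x y]; first by rewrite -mono10 hmap_mono rmorph1.
apply: hahnP => c; rewrite hcoefM /= /conv.
have [X XP] := conv_fset c (hcoefP x) (hcoefP y).
rewrite !(fsumE (X := X)) ?rmorph_sum => [|a /=|//].
  by apply: eq_bigr => a _; rewrite rmorphM.
rewrite -rmorphM => xa; apply: XP; apply: contraNneq xa => ->.
by rewrite rmorph0.
Qed.
HB.instance Definition _ :=
  GRing.isMonoidMorphism.Build (hahn R o) (hahn R' o) hmap hmap_multiplicative.

Lemma hmap_theta (l : {additive A -> int}) x : hmap (theta l x) = theta l (hmap x).
Proof. by apply: hahnP => c /=; rewrite raddfMz. Qed.

Lemma hmap_zpow x y z : hmap (zpow x y z) = zpow (hmap x) (hmap y) z.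
Proof. by case: z => m; rewrite /= rmorphXn. Qed.

End HMap.

(* Lifting the coefficients of [tau] along a surjection from a torsion-free ring
   covers the fields of positive characteristic. *)
Lemma coef_core_field (K : fieldType) (A : zmodType) (o : toa A) (n : nat)
    (l : 'I_n -> {additive A -> int}) (a : 'I_n -> A) (tau y : 'I_n -> hahn K o) :
  (forall i, pos o (nz (tau i))) -> (forall i, (1 + tau i) * y i = 1) ->
  forall c, (forall j, l j c = 0) -> forall k,
  (mpow a tau y k * \det (ldlog l a tau y)) c =
  if k == 0 then (\det (expmat l a))%:~R * (c == 0)%:R else 0.
Proof.
move=> ptau uy c lc k.
have wlift0 (x : K) : wlift x != 0 -> x != 0.
  by apply: contraNneq => ->; rewrite /wlift eqxx.
have wo_lift i : wo o (nz (fun b => wlift (tau i b))).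
  by apply: wo_sub (hcoefP (tau i)) => b; exact: wlift0.
pose tau' i := Hahn (wo_lift i).
have ptau' i : pos o (nz (tau' i)) by move=> b /wlift0; exact: ptau.
have /choice[y' uy'] i : exists y', (1 + tau' i) * y' = 1.
  by have [y' ? _] := inv1p (ptau' i); exists y'.
have tauE i : hmap (@wproj K) (tau' i) = tau i.
  by apply: hahnP => b; exact: wliftK.
(* Inverses are unique, so the inverse found over the lifted ring specialises to the given [y i]. *)
have yE i : hmap (@wproj K) (y' i) = y i.
  have := congr1 (@hmap _ _ (@wproj K) _ o) (uy' i).
  rewrite rmorphM rmorphD rmorph1 /= tauE => E.
  by rewrite -[LHS]mul1r -(uy i) mulrAC E rmorph1 mul1r.
have /(congr1 (@wproj K)) := coef_core a ptau' uy' (@wtorsfree K) lc k.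
have -> : mpow a tau y k * \det (ldlog l a tau y) =
    hmap (@wproj K) (mpow a tau' y' k * \det (ldlog l a tau' y')).
  rewrite rmorphM /mpow rmorphM rmorph_prod /= hmap_mono rmorph1.
  congr (_ * _ * _).
    by apply: eq_bigr => i _; rewrite hmap_zpow rmorphD rmorph1 /= tauE yE.
  rewrite -det_map_mx; congr (\det _); apply/matrixP => i j.
  rewrite !mxE rmorphD rmorph_int /dlog rmorphM /= hmap_theta yE.
  by rewrite rmorphD rmorph1 /= tauE.
move=> /= ->; case: ifP => _; last exact: rmorph0.
by rewrite rmorphM rmorph_int rmorph_nat.
Qed.

(** * The series of the statement as elements of the ring of Hahn series *)

Lemma gen_sub (A : zmodType) (S T : set A) : S `<=` T -> gen S `<=` gen T.
Proof. by move=> ST c [w wS ->]; exists w => // x /wS/ST. Qed.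

Section Bridge.
Variables (K : fieldType) (G : zmodType) (n : nat).
Local Notation A := (G * 'rV[int]_n)%type.
Variable o : toa A.
Local Notation H := (hahn K o).
Implicit Types (x y : H) (f : series K G n).

Lemma fst_sum (I : Type) (r : seq I) (F : I -> A) :
  (\sum_(i <- r) F i).1 = \sum_(i <- r) (F i).1.
Proof. by elim/big_rec2: _ => // i y1 y2 _ <-. Qed.

Lemma snd_sum (I : Type) (r : seq I) (F : I -> A) :
  (\sum_(i <- r) F i).2 = \sum_(i <- r) (F i).2.
Proof. by elim/big_rec2: _ => // i y1 y2 _ <-. Qed.

Lemma pairMz (a : A) (z : int) : a *~ z = (a.1 *~ z, a.2 *~ z).
Proof.
have pairMn m : a *+ m = (a.1 *+ m, a.2 *+ m).
  by elim: m => [|m IH]; rewrite ?mulr0n // !mulrS IH.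
by case: z => m; rewrite ?NegzE ?mulrNz -!pmulrn pairMn.
Qed.

Definition xdeg (j : 'I_n) (a : A) : int := a.2 0 j.
Fact xdeg_additive j : zmod_morphism (xdeg j).
Proof. by move=> a b; rewrite /xdeg !mxE. Qed.
HB.instance Definition _ j := GRing.isZmodMorphism.Build A int (xdeg j) (xdeg_additive j).
Definition xdegs (j : 'I_n) : {additive A -> int} := xdeg j.

Lemma hmulE f g : hmul f g = conv f g.
Proof.
apply/funext => c; rewrite /hmul /conv /fsum.
rewrite (reindex_fsbig (fun a : A => (a, c - a)) [set a | f a * g (c - a) != 0]).
  by apply: fsbig_widen => // a [_ /negP/negPn/eqP].
split=> [a /= fa|a b _ _ [] //|[a b] /= [ab fab]].
  split=> //; rewrite /gadd /=; case: (c) (a) => [c1 c2] [a1 a2] /=.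
  by rewrite ![_ + (_ - _)]addrC !subrK.
have E : b = c - a by rewrite -ab; apply/eqP; rewrite eq_sym subr_eq addrC.
by exists a; rewrite E in fab *.
Qed.

Lemma hmul_hahn x y : hmul x y = x * y :> series K G n.
Proof. exact: hmulE. Qed.

Lemma hmono_hahn a : hmono K a = (mono 1 a : H) :> series K G n.
Proof. by apply/funext => c; rewrite /hmono /=; case: eqP. Qed.

Lemma hone_hahn : @hone K G n = (1 : H).
Proof. exact: hmono_hahn. Qed.

Lemma hprod_hahn (I : finType) (X : I -> H) :
  \big[@hmul K G n/@hone K G n]_i hcoef (X i) = \prod_i X i.
Proof.
elim/big_rec2: _ => [|i x f _ ->]; first exact: hone_hahn.
exact: hmul_hahn.
Qed.

Lemma hexp_hahn x m : hexp x m = x ^+ m :> series K G n.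
Proof.
elim: m => [|m IH]; first exact: hone_hahn.
by rewrite /hexp iterS -/(hexp x m) IH hmul_hahn exprS.
Qed.

(** The series chosen by [epsilon] is an inverse because [y] shows that one exists; it equals [y] by
    uniqueness in the ring of Hahn series. *)
Lemma hinv_hahn x y : x * y = 1 -> hinv o x = y :> series K G n.
Proof.
move=> xy; rewrite /hinv; set P := fun h => _.
have [wz] : P (ClassicalEpsilon.epsilon (inhabits (@hzero K G n)) P).
  apply: ClassicalEpsilon.epsilon_spec; exists y; split; first exact: hcoefP.
  by rewrite hmul_hahn xy hone_hahn.
set h := ClassicalEpsilon.epsilon _ _ in wz * => E.
pose z : H := Hahn wz.
have xz : x * z = 1 by apply: hahnP => c; rewrite -hmul_hahn E hone_hahn.
have -> : h = z by [].
by rewrite -[z]mul1r -xy mulrAC xz mul1r.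
Qed.

Lemma ipow_hahn x y z : x * y = 1 -> ipow o x z = zpow x y z :> series K G n.
Proof. by move=> xy; case: z => m; rewrite /ipow /zpow ?(hinv_hahn xy) hexp_hahn. Qed.

Lemma hderiv_hahn j x :
  hderiv j x = mono 1 (0, - delta_mx 0 j) * theta (xdegs j) x :> series K G n.
Proof.
apply/funext => c; rewrite monoM_coef mul1r /= /hderiv /xdeg.
have -> : c - (0, - delta_mx 0 j) = (c.1, c.2 + delta_mx 0 j) :> A.
  by rewrite [LHS]surjective_pairing /= subr0 opprK.
by rewrite mulrzl !mxE !eqxx.
Qed.

Lemma jacobian_hahn (X : 'I_n -> H) : jacobian (fun i => hcoef (X i)) =
  (mono 1 (0, - const_mx 1) * \det (\matrix_(i, j) theta (xdegs j) (X i)))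
  :> series K G n.
Proof.
(* Each partial derivative is [x_j^(-1)] times an Euler derivation, so the Jacobian matrix is [M]
   with column [j] scaled by [x_j^(-1)]. *)
pose d : 'rV[H]_n := \row_j mono 1 (0, - delta_mx 0 j).
pose M := \matrix_(i, j) theta (xdegs j) (X i).
transitivity (\det (M *m diag_mx d) : series K G n); last first.
  rewrite det_mulmx det_diag mulrC; congr (hcoef (_ * _)).
  under eq_bigr do rewrite mxE.
  suff E (r : seq 'I_n) : \prod_(j <- r) (mono 1 (0, - delta_mx 0 j) : H) =
      mono 1 (0, - \sum_(j <- r) delta_mx 0 j).
    rewrite E; congr (mono 1 (0, - _)); apply/rowP => j.
    rewrite summxE mxE (bigD1 j) //= mxE !eqxx big1 ?addr0 // => i /negPf ni.
    by rewrite mxE eq_sym ni.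
  elim: r => [|j r IH]; first by rewrite !big_nil oppr0 mono10.
  rewrite !big_cons IH monoM mulr1 opprD; congr (mono 1 (_, _)).
  by rewrite /= addr0.
rewrite /jacobian /determinant.
elim/big_rec2: _ => [|s x f _ ->]; first by apply/funext.
apply/funext => c; rewrite hcoefD /hadd; congr (_ + _).
have -> : \big[@hmul K G n/@hone K G n]_(i < n) hderiv (s i) (X i) =
    \prod_i (M *m diag_mx d) i (s i).
  rewrite -hprod_hahn; apply: eq_bigr => i _; rewrite hderiv_hahn.
  by rewrite mul_mx_diag !mxE mulrC.
rewrite /hscale !mulr_sign; case: (odd_perm s); rewrite ?hcoefN //.
Qed.

End Bridge.
Arguments xdegs {G n} j.

(** * Convergence of [Phi(F)] and the residue formula *)

Section Residue.
Variables (K : fieldType) (G : zmodType) (n : nat).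
Local Notation A := (G * 'rV[int]_n)%type.
Variable o : toa A.
Local Notation H := (hahn K o).
Variables (F : 'I_n -> H) (b : 'I_n -> 'rV[int]_n) (g : 'I_n -> G).
Hypothesis Finit : forall i, is_initial_exp o (F i) (g i, b i).
Hypothesis detb : \det (expmx b) != 0.
Variable Phi : series K G n.
Hypothesis Phi_wo : in_Kw (le_rho o (fendo g b)) Phi.

Let a i : A := (g i, b i).
Let C i : K := F i (a i).
Let tau i : H := mono (C i)^-1 (- a i) * F i - 1.

Lemma lead_neq0 i : C i != 0.
Proof. by case: (Finit i). Qed.

Lemma tau_coef i c : tau i c = (C i)^-1 * F i (c + a i) - (c == 0)%:R.
Proof. by rewrite hcoefD hcoefN hcoef1 monoM_coef opprK. Qed.

(** Subtracting 1 removes exactly the coefficient at 0, and minimality of [a i] puts the remaining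
    support above 0. *)
Lemma tau_pos i : pos o (nz (tau i)).
Proof.
move=> c tc; change (is_true (tau i c != 0)) in tc; rewrite tau_coef in tc.
have nc : c != 0.
  apply: contraNneq tc => ->; rewrite add0r eqxx mulVf ?subrr //.
  exact: lead_neq0.
split; last exact/eqP.
have Fc : F i (c + a i) != 0.
  by apply: contraNneq tc => ->; rewrite mulr0 (negPf nc) subr0.
by apply: (tle_addr2 (c := a i)); rewrite add0r; case: (Finit i) => _; apply.
Qed.

Lemma F_factor i : F i = mono (C i) (a i) * (1 + tau i).
Proof.
rewrite /tau addrC subrK mulrA monoM divff ?lead_neq0 // subrr.
by rewrite mono10 mul1r.
Qed.

Definition uinv i : H := projT1 (cid2 (inv1p (@tau_pos i))).

Lemma uinvP i : (1 + tau i) * uinv i = 1.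
Proof. by rewrite /uinv; case: cid2. Qed.

Lemma uinv_gen i : nz (uinv i) `<=` gen (nz (tau i)).
Proof. by rewrite /uinv; case: cid2. Qed.

Definition Finv i : H := mono (C i)^-1 (- a i) * uinv i.

Lemma FinvP i : F i * Finv i = 1.
Proof.
rewrite F_factor mulrACA monoM divff ?lead_neq0 // subrr.
by rewrite mono10 mul1r uinvP.
Qed.

Definition Fmon (k : 'rV[int]_n) : H := \prod_i zpow (F i) (Finv i) (k 0 i).

Definition coefpow (k : 'rV[int]_n) : K := \prod_i C i ^ k 0 i.

Lemma zpow_mono (r : K) (c : A) z : r != 0 ->
  zpow (mono r c : H) (mono r^-1 (- c)) z = mono (r ^ z) (c *~ z).
Proof.
move=> nr.
have expm s d m : (mono s d : H) ^+ m = mono (s ^+ m) (d *+ m).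
  by elim: m => [|m IH]; rewrite ?mono10 // exprS IH monoM -exprS -mulrS.
case: z => m; first exact: expm.
by rewrite /zpow expm exprVn NegzE mulrNz mulNrn.
Qed.

Lemma Fmon_mpow k : Fmon k = mono (coefpow k) 0 * mpow a tau uinv k.
Proof.
rewrite /Fmon /mpow mulrA monoM mulr1 add0r /coefpow.
under eq_bigr => i _ do
  rewrite {1}F_factor zpowM (zpow_mono _ _ (lead_neq0 i)).
rewrite big_split /=; congr (_ * _).
by elim/big_rec3: _ => [|i z s m _ ->]; rewrite ?mono10 // monoM.
Qed.

(** A constant factor cancels in a logarithmic derivative, so the leading coefficients [C i] leave
    no trace in [ldlog]. *)
Lemma ldlogE i j : ldlog xdegs a tau uinv i j = theta (xdegs j) (F i) * Finv i.
Proof.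
rewrite {1}F_factor thetaM theta_mono /Finv mulrDl !mxE; congr (_ + _).
  rewrite mulrACA uinvP mulr1 mulrzAl monoM divff ?lead_neq0 // subrr mono10.
  by [].
by rewrite mulrACA monoM divff ?lead_neq0 // subrr mono10 mul1r.
Qed.

Lemma expmatE : expmat xdegs a = expmx b.
Proof. by apply/matrixP => i j; rewrite !mxE. Qed.

(** The leading coefficients enter only through the scalar [coefpow k], which is 1 for [k = 0] and
    multiplies 0 otherwise. *)
Lemma coef_Fmon_ldlog k (g' : G) :
  (Fmon k * \det (ldlog xdegs a tau uinv)) (g', 0) =
  if k == 0 then (\det (expmx b))%:~R * (g' == 0)%:R else 0.
Proof.
rewrite Fmon_mpow -mulrA monoM_coef subr0 coef_core_field; last first.
- by move=> j; rewrite /= /xdeg mxE.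
- exact: uinvP.
- exact: tau_pos.
rewrite expmatE; case: eqVneq => [->|_]; last by rewrite mulr0.
rewrite /coefpow big1 ?mul1r => [|i _]; last by rewrite mxE expr0z.
have -> // : ((g', 0) == 0 :> A) = (g' == 0).
by apply/eqP/eqP => [/(congr1 fst)|->].
Qed.

Definition phi (k : 'rV[int]_n) : series K G n :=
  fun c => if c.2 == 0 then Phi (c.1, k) else 0.

(** Thus [fendo] gives the exponent of the initial term of [t^g1 F^k], which links [le_rho] to the
    supports of the terms of [Phi(F)]. *)
Lemma fendoE (g1 : G) (k : 'rV[int]_n) :
  fendo g b (g1, k) = (g1, 0) + \sum_i a i *~ k 0 i.
Proof.
rewrite [RHS]surjective_pairing /= fst_sum snd_sum add0r /fendo /=.
congr (_ + _, _); first by apply: eq_bigr => i _; rewrite pairMz.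
rewrite mulmx_sum_row; apply: eq_bigr => i _; rewrite pairMz /=.
rewrite -[k 0 i in LHS]intz scaler_int; congr (_ *~ _).
by apply/rowP => j; rewrite !mxE.
Qed.

(** Multiplying by the adjugate shows that [\det (expmx b)] kills the difference of the
    [x]-exponents. *)
Lemma fendo_inj : injective (fendo g b).
Proof.
move=> [g1 k1] [g2 k2] [E1 E2].
suff k12 : k1 = k2 by move: E1; rewrite k12 => /addIr->.
apply/eqP; rewrite -subr_eq0; apply/eqP/rowP => i.
have : (k1 - k2) *m expmx b = 0 by rewrite mulmxBl E2 subrr.
move=> /(congr1 (mulmx^~ (\adj (expmx b)))); rewrite -mulmxA mul_mx_adj mul0mx.
rewrite mul_mx_scalar => /rowP/(_ i); rewrite !mxE => /eqP.
by rewrite mulf_eq0 (negPf detb) => /eqP.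
Qed.

(** For fixed [k] the map [fendo] acts on the [G]-component by a translation, so on this slice
    [le_rho] is the original order. *)
Lemma wo_phi k : wo o (nz (phi k)).
Proof.
move=> U Uphi [c Uc].
have U0 d : U d -> d.2 = 0 /\ Phi (d.1, k) != 0.
  by move=> /Uphi; rewrite /nz /phi /=; have [//|_] := eqVneq d.2 0; rewrite eqxx.
have [||m [d Ud <-] mmin] := Phi_wo (U := [set e | exists2 d, U d & (d.1, k) = e]).
- by move=> _ [d Ud <-]; case: (U0 d Ud).
- by exists (c.1, k), c.
exists d => // e Ue; have := mmin (e.1, k) (ex_intro2 _ _ e Ue erefl).
rewrite /le_rho !fendoE => /tle_addr2.
rewrite [d]surjective_pairing [e]surjective_pairing.
by have [-> _] := U0 d Ud; have [-> _] := U0 e Ue.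
Qed.

Definition hphi k : H := Hahn (@wo_phi k).

Lemma hphiE k c : hphi k c = if c.2 == 0 then Phi (c.1, k) else 0.
Proof. by []. Qed.

Lemma hphi0 k g0 : hphi k (g0, 0) = Phi (g0, k).
Proof. by rewrite hphiE eqxx. Qed.

Let S : set A := [set c | exists i, nz (tau i) c].

Lemma wo_S : wo o S.
Proof. by apply: wo_bigcup => i; exact: hcoefP. Qed.

Lemma pos_S : pos o S.
Proof. by move=> c [i]; exact: tau_pos. Qed.

Lemma prod_gen (k : 'rV[int]_n) :
  nz (\prod_i zpow (1 + tau i) (uinv i) (k 0 i) : H) `<=` gen S.
Proof.
have one : nz (1 : H) `<=` gen S.
  move=> c; change (is_true ((1 : H) c != 0) -> gen S c); rewrite hcoef1.
  by have [->|_] := eqVneq c 0; rewrite ?eqxx // => _; exact: gen0.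
have mul (x y : H) : nz x `<=` gen S -> nz y `<=` gen S -> nz (x * y) `<=` gen S.
  exact: hcoefM_sub (@genD _ S).
have expS (x : H) m : nz x `<=` gen S -> nz (x ^+ m) `<=` gen S.
  by move=> xS; elim: m => [//|m IH]; rewrite exprS; exact: mul.
elim/big_ind: _ => // i _; case: (k 0 i) => m; apply: expS.
  move=> c; change (is_true ((1 + tau i) c != 0) -> gen S c); rewrite hcoefD => uc.
  have [c1|c1] := eqVneq ((1 : H) c) 0; last exact: one.
  apply: gen1; exists i; change (is_true (tau i c != 0)).
  by apply: contraNneq uc => tc; rewrite c1 tc addr0.
apply: subset_trans (@uinv_gen i) _; apply: gen_sub => c tc.
by exists i.
Qed.

(** [F^k] is a scalar times its initial monomial times a product supported in [gen S]; the monomial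
    moves an exponent [(g1, 0)] of [phi_k] to [fendo g b (g1, k)]. *)
Lemma term_support k c : (hphi k * Fmon k) c != 0 ->
  exists g1, Phi (g1, k) != 0 /\ gen S (c - fendo g b (g1, k)).
Proof.
rewrite Fmon_mpow /mpow !mulrA -[hphi k * _ * _]mulrA monoM -mulrA => /conv_neq0.
move=> [d [pd]]; rewrite monoM_coef add0r => /mulr_neq0P[_ /prod_gen gd].
move: pd; rewrite /= /phi; have [d0 pd|_] := eqVneq d.2 0; last by rewrite eqxx.
exists d.1; split=> //; rewrite fendoE opprD addrA.
by rewrite (_ : (d.1, 0) = d) // [RHS]surjective_pairing d0.
Qed.

Let fam k : series K G n := hphi k * Fmon k.

(** All supports lie in the sum of the well-ordered sets [V] and [gen S]. An exponent has finitely
    many decompositions there, and the [V]-component determines [k] because [fendo] is injective. *)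
Lemma fam_summable : summable o fam.
Proof.
pose V := [set d | exists2 e, Phi e != 0 & d = fendo g b e].
have wV : wo o V.
  move=> U UV [d Ud].
  have [||m [Pm Um] mmin] := Phi_wo (U := [set e | Phi e != 0 /\ U (fendo g b e)]).
  - by move=> e [].
  - by have [e Pe E] := UV d Ud; exists e; split=> //; rewrite -E.
  exists (fendo g b m) => // e Ue; have [e' Pe' E] := UV e Ue.
  by rewrite E; apply: mmin; split=> //; rewrite -E.
have wM := wo_gen wo_S pos_S.
split=> [|c].
  apply: wo_sub (wo_sumset wV wM) => c [k /term_support[g1 [Pg gc]]].
  exists (fendo g b (g1, k)), (c - fendo g b (g1, k)); split=> //.
    by exists (g1, k).
  by rewrite addrCA subrr addr0.
(* A left inverse of [fendo], with the arbitrary value 0 off its image. *)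
have /choice[inv invP] d : exists e, forall e', fendo g b e' = d -> e' = e.
  have [[e E]|ne] := pselect (exists e, fendo g b e = d).
    by exists e => e'; rewrite -E => /fendo_inj.
  by exists 0 => e' E; case: ne; exists e'.
apply: (sub_finite_set _ (finite_image (fun d => (inv d).2) (finite_sum_pairs c wV wM))).
move=> k /term_support[g1 [Pg gc]]; exists (fendo g b (g1, k)).
  by split=> //; exists (g1, k).
by rewrite -(invP _ _ erefl).
Qed.

Lemma hsum_fsum c : hsum fam c = \sum_(k \in [set: 'rV[int]_n]) fam k c.
Proof. by apply: fsbig_widen => // k [_ /negP/negPn/eqP]. Qed.

Lemma wo_hsum : wo o (nz (hsum fam)).
Proof.
apply: wo_sub fam_summable.1 => c; rewrite /nz /= hsum_fsum => /fsum_neq0[k kc].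
by exists k.
Qed.

Definition PhiF : H := Hahn wo_hsum.

(** Finitely many exponents of the family can meet [Q] at [c], and each occurs in finitely many
    terms; this finite rectangle justifies exchanging the sums. *)
Lemma coef_PhiF_mul (Q : H) c : (PhiF * Q) c = fsum (fun k => (hphi k * Fmon k * Q) c).
Proof.
rewrite hcoefM /conv /=.
have [fw ff] := fam_summable.
have fX := finite_sum_pairs c fw (hcoefP Q).
have [X XP] := finite_fset fX.
have [Y YP] := finite_fset (bigcup_finite fX (fun d _ => ff d)).
transitivity (fsum (fun d => \sum_(k \in [set: 'rV[int]_n]) fam k d * Q (c - d))).
  apply: eq_fsum => d; rewrite hsum_fsum.
  by have [Z ZP] := finite_fset (ff d); exact: fsum_mulr ZP.
rewrite (fsum_exchange (X := X) (Y := Y)) // => d k /mulr_neq0P[fd Qd].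
have dX : [set d | (exists k, fam k d != 0) /\ nz Q (c - d)] d by split=> //; exists k.
by split; [exact: XP | apply: YP; exists d].
Qed.

(** The case [e = 0] gives the constant term formula; [e = (1, ..., 1)] gives the residue formula,
    the Jacobian being [F_1 ... F_n] times the logarithmic one up to a monomial in [x]. *)
Lemma coef_PhiF e (g0 : G) : (forall k, Fmon k * Fmon e = Fmon (k + e)) ->
  (PhiF * (Fmon e * \det (ldlog xdegs a tau uinv))) (g0, 0) =
  (\det (expmx b))%:~R * Phi (g0, - e).
Proof.
move=> Fe; rewrite coef_PhiF_mul.
have E k : (hphi k * Fmon k * (Fmon e * \det (ldlog xdegs a tau uinv))) (g0, 0) =
    if k + e == 0 then (\det (expmx b))%:~R * Phi (g0, k) else 0.
  (* Only the exponent [(g0, 0)] of [phi_k] contributes: among exponents without [x]-part, the other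
     factor has at most the coefficient at 0. *)
  rewrite -mulrA [Fmon k * _]mulrA Fe hcoefM /conv (fsum1 (i0 := (g0, 0))).
    rewrite hphi0 subrr (coef_Fmon_ldlog _ 0).
    by case: ifP; rewrite ?mulr0 // eqxx mulr1 mulrC.
  move=> d nd; rewrite hphiE; have [d0|_] := eqVneq d.2 0; last by rewrite mul0r.
  have -> : (g0, 0) - d = (g0 - d.1, 0).
    by rewrite [LHS]surjective_pairing /= d0 subr0.
  rewrite coef_Fmon_ldlog; case: ifP; rewrite ?mulr0 // subr_eq0.
  have [gd|_] := eqVneq g0 d.1; last by rewrite !mulr0.
  by case/eqP: nd; rewrite [LHS]surjective_pairing d0 gd.
rewrite (eq_fsum E) (fsum1 (i0 := - e)) ?addNr ?eqxx // => k.
by rewrite addr_eq0 => /negPf->.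
Qed.

Lemma Fmon0 : Fmon 0 = 1.
Proof. by rewrite /Fmon big1 // => i _; rewrite mxE. Qed.

Lemma FmonS k : Fmon k * Fmon (const_mx 1) = Fmon (k + const_mx 1).
Proof.
rewrite /Fmon -big_split; apply: eq_bigr => i _ /=.
by rewrite !mxE zpowS ?FinvP // expr1.
Qed.

Lemma subst_term_hahn k : subst_term o Phi (fun i => hcoef (F i)) k = fam k.
Proof.
rewrite /subst_term /Fpow.
under eq_bigr => i _ do rewrite (ipow_hahn _ (FinvP i)).
by rewrite hprod_hahn -[LHS]/(hmul (hphi k) (Fmon k)) hmul_hahn.
Qed.

Lemma det_theta : \det (\matrix_(i, j) theta (xdegs j) (F i)) =
  Fmon (const_mx 1) * \det (ldlog xdegs a tau uinv).
Proof.
have -> : Fmon (const_mx 1) = \det (diag_mx (\row_i F i)).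
  by rewrite det_diag; apply: eq_bigr => i _; rewrite !mxE /= expr1.
rewrite -det_mulmx mul_diag_mx; congr (\det _); apply/matrixP => i j.
by rewrite mxE [RHS]mxE mxE ldlogE mulrCA FinvP mulr1.
Qed.

(** The product of the [F i] from [det_theta] cancels their inverses, and [x_1 ... x_n] cancels the
    monomial factor of the Jacobian. *)
Lemma logjacobian_hahn :
  logjacobian o (fun i => hcoef (F i)) = \det (ldlog xdegs a tau uinv) :> series K G n.
Proof.
rewrite /logjacobian jacobian_hahn.
under eq_bigr => i _ do rewrite (hinv_hahn (FinvP i)).
rewrite hprod_hahn /xmono (hmono_hahn _ o) !hmul_hahn det_theta.
have FF : (\prod_i Finv i) * Fmon (const_mx 1) = 1.
  by rewrite /Fmon -big_split big1 // => i _ /=; rewrite mxE /= expr1 mulrC FinvP.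
rewrite mulrACA monoM mulr1 [_ + _](_ : _ = 0).
  by rewrite mono10 mul1r mulrA FF mul1r.
by rewrite [LHS]surjective_pairing /= addr0 subrr.
Qed.

Lemma residue :
  summable o (subst_term o Phi (fun i => hcoef (F i))) /\
  (forall g0 : G,
     hmul (hsum (subst_term o Phi (fun i => hcoef (F i))))
       (jacobian (fun i => hcoef (F i))) (g0, const_mx (-1)) =
     (\det (expmx b))%:~R * Phi (g0, const_mx (-1))) /\
  (forall g0 : G,
     hmul (hsum (subst_term o Phi (fun i => hcoef (F i))))
       (logjacobian o (fun i => hcoef (F i))) (g0, 0) =
     (\det (expmx b))%:~R * Phi (g0, 0)).
Proof.
rewrite (funext subst_term_hahn) -[hsum fam]/(hcoef PhiF).
have N1 : const_mx (-1) = - const_mx 1 :> 'rV[int]_n by apply/rowP => j; rewrite !mxE.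
split; first exact: fam_summable.
split=> g0.
  (* The monomial factor of the Jacobian turns the coefficient at [x^(-1, ..., -1)] into one of the
     constant term. *)
  rewrite jacobian_hahn hmul_hahn det_theta mulrCA monoM_coef mul1r N1.
  rewrite -coef_PhiF; last exact: FmonS.
  by congr (hcoef _ _); rewrite [LHS]surjective_pairing /= subr0 subrr.
rewrite logjacobian_hahn hmul_hahn -[in RHS]oppr0 -coef_PhiF ?Fmon0 ?mul1r //.
by move=> k; rewrite ?Fmon0 mulr1 addr0.
Qed.

End Residue.

Theorem mainTheorem6 (K : fieldType) (G : zmodType) (n : nat)
  (le : grp G n -> grp G n -> Prop) (hle : is_toa le)
  (F : 'I_n -> series K G n)
  (hFw : forall i, in_Kw le (F i)) (hF0 : forall i, F i != @hzero K G n)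
  (b : 'I_n -> 'rV[int]_n) (g : 'I_n -> G)
  (hxinit : forall i, is_xinit_exp le (F i) (b i))
  (hinit : forall i, is_initial_exp le (F i) (g i, b i))
  (hj : \det (expmx b) != 0)
  (Phi : series K G n) (hPhi : in_Kw (le_rho le (fendo g b)) Phi) :
  summable le (subst_term le Phi F) /\
  (forall g0 : G,
     hmul (hsum (subst_term le Phi F)) (jacobian F) (g0, const_mx (-1)) =
     (\det (expmx b))%:~R * Phi (g0, const_mx (-1))) /\
  (forall g0 : G,
     hmul (hsum (subst_term le Phi F)) (logjacobian le F) (g0, 0) =
     (\det (expmx b))%:~R * Phi (g0, 0)).
Proof.
case: hle => refl anti trans total add.
pose o : toa (G * 'rV[int]_n)%type := Toa refl anti trans total add.
exact: (@residue K G n o (fun i => @Hahn K _ o (F i) (hFw i)) b g hinit hj Phi hPhi).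
Qed.
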